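(* Every $Q$-polynomial distance-regular graph is sharp over $\mathbb{R}$. That is, if $\Gamma$ is a distance-regular graph with vertex set $X$ and diameter $D\ge 1$ that admits a $Q$-polynomial ordering of its primitive idempotents, then for every vertex $y\in X$, every irreducible $T^{\mathbb{R}}(y)$-module $W$ satisfies $\dim_{\mathbb{R}}(E_r^*(y)W)=1$, where $r$ is the endpoint of $W$.
   Context: $\Gamma$ is a finite, undirected, connected graph without loops or multiple edges, with vertex set $X$, path-length distance $\partial$ and diameter $D=\max\{\partial(y,z)\mid y,z\in X\}$. It is distance-regular: for all $0\le h,i,j\le D$ and all $y,z\in X$ with $\partial(y,z)=h$, the number $p^h_{i,j}=|\{w\in X\mid \partial(y,w)=i,\ \partial(z,w)=j\}|$ depends only on $h,i,j$. All matrices have rows and columns indexed by $X$. The adjacency matrix $A$ has $D+1$ distinct real eigenvalues $\theta_0,\dots,\theta_D$, with $\theta_0$ equal to the valency; the primitive idempotent $E_i$ is the matrix of the orthogonal projection onto the $\theta_i$-eigenspace of $A$. With $\circ$ the entrywise product, the Krein parameters $q^h_{i,j}$ are defined by $E_i\circ E_j=|X|^{-1}\sum_{h=0}^D q^h_{i,j}E_h$. The ordering $\{E_i\}_{i=0}^D$ is $Q$-polynomial if for all $0\le h,i,j\le D$: $q^h_{i,j}=0$ whenever one of $h,i,j$ is greater than the sum of the other two, and $q^h_{i,j}\ne0$ whenever one of $h,i,j$ equals the sum of the other two. The graph is $Q$-polynomial if at least one such ordering exists. For $y\in X$ and $0\le i\le D$, $E_i^*(y)$ is the diagonal matrix with $(z,z)$-entry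 $1$ if $\partial(y,z)=i$ and $0$ otherwise. The Terwilliger algebra $T^{\mathbb{R}}(y)$ is the subalgebra of the algebra $\mathrm{Mat}_X(\mathbb{R})$ of real matrices generated by $A$ and $E_0^*(y),\dots,E_D^*(y)$. A $T^{\mathbb{R}}(y)$-module is a subspace $W$ of $\mathbb{R}^X$ with $T^{\mathbb{R}}(y)W\subseteq W$; it is irreducible if $W\ne0$ and it contains no $T^{\mathbb{R}}(y)$-module other than $0$ and $W$. The endpoint of an irreducible module $W$ is $\min\{i\mid E_i^*(y)W\neq 0\}$. *)

(* Defs.v *)
From HB Require Import structures.
From mathcomp Require Import all_boot all_order all_algebra.
From mathcomp Require Export reals.
Set Implicit Arguments.
Unset Strict Implicit.
Unset Printing Implicit Defensive.
Import Order.TTheory GRing.Theory Num.Theory.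
Local Open Scope ring_scope.

(* A simple graph on X is a symmetric irreflexive relation e : rel X; these two *)
(* properties, and connectedness, are hypotheses of the theorem.                *)

Section Distance.
Variables (X : finType) (e : rel X).

(* In a connected graph two vertices are joined by a walk with fewer than #|X|  *)
(* edges; gdist is #|X| for vertices lying in different components.             *)
Definition gdist (y z : X) : nat :=
  find (fun n => [exists p : n.-tuple X, path e y p && (last y p == z)])
       (iota 0 #|X|).

Definition diameter : nat := (\max_(y : X) \max_(z : X) gdist y z)%N.

Definition distance_regular : Prop :=
  forall (h i j : 'I_diameter.+1) (y z y' z' : X),
    gdist y z = h -> gdist y' z' = h ->
    #|[set w | (gdist y w == i) && (gdist z w == j)]| =
    #|[set w | (gdist y' w == i) && (gdist z' w == j)]|.

End Distance.

Section Algebra.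
Variables (R : realType) (X : finType) (e : rel X).

Local Notation D := (diameter e).
(* Mat_X(R) and R^X, with X enumerated by enum_val : 'I_#|X| -> X. *)
Local Notation MatX := 'M[R]_#|X|.
Local Notation RX := 'cV[R]_#|X|.

Definition adjmx : MatX :=
  \matrix_(i, j) (e (enum_val i) (enum_val j))%:R.

(* theta lists the distinct eigenvalues of the adjacency matrix, the valency    *)
(* (the number of neighbours of any vertex) coming first.                       *)
Definition eigenvalue_ordering (theta : 'I_D.+1 -> R) : Prop :=
  [/\ injective theta,
      forall a : R, eigenvalue adjmx a <-> exists i, theta i = a
    & forall y : X, theta ord0 = #|[set z | e y z]|%:R].

(* Orthogonal projection onto the a-eigenspace, along its orthogonal            *)
(* complement {u | u *m U^T = 0}. The library's eigenspaces consist of row      *)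
(* vectors; this is immaterial because adjmx and orthogonal projections are     *)
(* symmetric matrices.                                                          *)
Definition primitive_idempotent (a : R) : MatX :=
  let U := eigenspace adjmx a in proj_mx U (kermx U^T).

(* The primitive idempotents are linearly independent, so q is unique.          *)
Definition krein_parameters (theta : 'I_D.+1 -> R)
    (q : 'I_D.+1 -> 'I_D.+1 -> 'I_D.+1 -> R) : Prop :=
  forall i j : 'I_D.+1,
    map2_mx *%R (primitive_idempotent (theta i)) (primitive_idempotent (theta j))
    = #|X|%:R^-1 *: \sum_(h < D.+1) q h i j *: primitive_idempotent (theta h).

Definition Q_polynomial_ordering (theta : 'I_D.+1 -> R) : Prop :=
  eigenvalue_ordering theta /\
  exists2 q, krein_parameters theta q &
    forall h i j : 'I_D.+1,
      ([|| (i + j < h)%N, (h + j < i)%N | (h + i < j)%N] -> q h i j = 0) /\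
      ([|| h == i + j :> nat, i == h + j :> nat | j == h + i :> nat]%N ->
         q h i j != 0).

Definition Q_polynomial : Prop := exists theta, Q_polynomial_ordering theta.

Definition dual_idempotent (y : X) (i : nat) : MatX :=
  diag_mx (\row_j (gdist e y (enum_val j) == i)%:R).

Inductive in_terwilliger (y : X) : MatX -> Prop :=
| terwilliger_adj : in_terwilliger y adjmx
| terwilliger_dual (i : 'I_D.+1) : in_terwilliger y (dual_idempotent y i)
| terwilliger_one : in_terwilliger y 1%:M
| terwilliger_add B C :
    in_terwilliger y B -> in_terwilliger y C -> in_terwilliger y (B + C)
| terwilliger_scale (a : R) B : in_terwilliger y B -> in_terwilliger y (a *: B)
| terwilliger_mul B C :
    in_terwilliger y B -> in_terwilliger y C -> in_terwilliger y (B *m C).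

Definition T_module (y : X) (W : {vspace RX}) : Prop :=
  forall (B : MatX) (v : RX), in_terwilliger y B -> v \in W -> B *m v \in W.

Definition irreducible_T_module (y : X) (W : {vspace RX}) : Prop :=
  [/\ T_module y W, W != 0%VS
    & forall U : {vspace RX}, T_module y U -> (U <= W)%VS ->
        U = 0%VS \/ U = W].

Definition dual_image (y : X) (i : nat) (W : {vspace RX}) : {vspace RX} :=
  (linfun (mulmx (dual_idempotent y i)) @: W)%VS.

(* Equal to D.+1 only when every dual_image y i W vanishes, i.e. when W = 0.    *)
Definition endpoint (y : X) (W : {vspace RX}) : nat :=
  find (fun i => dual_image y i W != 0%VS) (iota 0 D.+1).

Definition sharp : Prop :=
  forall (y : X) (W : {vspace RX}), irreducible_T_module y W ->
    \dim (dual_image y (endpoint y W) W) = 1%N.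

End Algebra.

(* Main.v *)
Require Import Defs.
From mathcomp Require Import all_boot all_order all_algebra reals.
From mathcomp Require Import boolp complex zify ring lra.

(* Write E_i for the primitive idempotents and E*_s for the projections onto the  *)
(* spheres around y. With A* the diagonal matrix of the y-row of E_1, both        *)
(* E*_s A E*_t and E_i A* E_j vanish when the indices differ by more than one, so *)
(*   sum_i f(theta_i) E*_s E_i E*_t = 0  and  sum_s f(theta*_s) E_i E*_s E_j = 0  *)
(* whenever deg f is smaller than the difference of the outer indices. On the     *)
(* bottom sphere E*_r W these relations make the antisymmetric part in (i, j) of  *)
(* u^T E_i E*_s E_j v a banded matrix that kills too many polynomials to be       *)
(* nonzero; hence the symmetric operators E*_r E_i E*_r commute there and have a  *)
(* common eigenvector u. The same relations rewrite any word                      *)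
(*   ... E*_{r+s_2} E_{i_3} E*_{r+s_1} E_{i_1} u                                  *)
(* into a combination of nested ones, with                                        *)
(*   0 <= s_1 <= s_2 <= ... <= i_3 <= i_1.                                        *)
(* A nested word that ends on the sphere r uses no other sphere, so it is a       *)
(* multiple of u, and E*_r W = E*_r T u is the line spanned by u.                 *)

Set Implicit Arguments.
Unset Strict Implicit.
Unset Printing Implicit Defensive.
Import Order.TTheory GRing.Theory Num.Theory.
Local Open Scope ring_scope.

(** * Interpolation modulo a subspace *)

(** Let r be the endpoint of W. Two facts make E*_r W a line. First, it contains a common
    eigenvector u of the compressions E*_r E_i E*_r ([sphere_eigenvector]): these are symmetric, and
    they commute because x^T E_i E*_s E_j v is symmetric in i and j for x, v on the bottom sphere
    ([word_bilinear_sym]). Second, by irreducibility W is spanned by the alternating words in the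
    E_i and E*_s applied to u ([sphere_line]), and the relations of [tridiagonal_horner] reduce
    every word to nested ones ([word_nested_span]): a letter outside its permitted range is removed
    by Lagrange interpolation, at the cost of words smaller in a lexicographic order. The
    Q-polynomial property enters through the tridiagonality of A* ([idem_dual_tri]) and the
    distinctness of its eigenvalues on the spheres ([idem1_separates]); the rest of the reduction is
    linear algebra of two families of idempotents. *)

Definition subspace_pred (F : fieldType) (V : lmodType F) (Z : V -> Prop) :=
  Z 0 /\ forall a v w, Z v -> Z w -> Z (a *: v + w).

Section SubspacePred.
Variables (F : fieldType) (V : lmodType F) (Z : V -> Prop).
Hypothesis Zsub : subspace_pred Z.

Lemma subspace_predD v w : Z v -> Z w -> Z (v + w).
Proof. by move=> Zv Zw; rewrite -[v]scale1r; apply: Zsub.2. Qed.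

Lemma subspace_predZ a v : Z v -> Z (a *: v).
Proof. by move=> Zv; rewrite -[_ *: _]addr0; apply: Zsub.2 => //; exact: Zsub.1. Qed.

Lemma subspace_pred_sum (I : Type) (r : seq I) (P : pred I) (c : I -> V) :
  (forall i, P i -> Z (c i)) -> Z (\sum_(i <- r | P i) c i).
Proof.
by move=> Zc; elim/big_ind: _ => //; [exact: Zsub.1 | exact: subspace_predD].
Qed.

Lemma subspace_pred_addr v w : Z v -> Z (v + w) -> Z w.
Proof.
move=> Zv Zvw; have -> : w = -1 *: v + (v + w) by rewrite scaleN1r addKr.
exact: Zsub.2.
Qed.

(* Lagrange interpolation: the polynomial vanishing at the other m - 1 points   *)
(* of the interval isolates a single coefficient.                               *)
Lemma vandermonde_subspace (N lo m : nat) (th : nat -> F) (c : nat -> V) :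
  {in [pred i | (i <= N)%N] &, injective th} ->
  (forall f : {poly F}, (size f <= m)%N ->
     Z (\sum_(y < N.+1) f.[th y] *: c y)) ->
  (forall y, (y <= N)%N -> ~~ (lo <= y < lo + m)%N -> Z (c y)) ->
  forall y, (y <= N)%N -> Z (c y).
Proof.
move=> th_inj sumZ outZ y leyN.
have [yin | ] := boolP (lo <= y < lo + m)%N; last exact: outZ.
pose r := [seq k <- rem y (iota lo m) | (k <= N)%N].
pose f : {poly F} := \prod_(k <- r) ('X - (th k)%:P).
have size_f : (size f <= m)%N.
  rewrite size_prod_XsubC size_filter (leq_ltn_trans (count_size _ _)) //.
  rewrite size_rem ?mem_iota // size_iota prednK //.
  by case: (m) yin => [|//]; rewrite addn0 ltnNge andbN.
have mem_r k : (k \in r) = [&& k != y, lo <= k < lo + m & k <= N]%N.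
  by rewrite mem_filter rem_filter ?iota_uniq // mem_filter mem_iota /= andbC -andbA.
have fy0 : f.[th y] != 0.
  rewrite horner_prod prodf_seq_neq0; apply/allP => k; rewrite mem_r => /and3P[neq _ lekN] /=.
  rewrite hornerXsubC subr_eq0; apply: contraNneq neq => /esym/th_inj -> //.
suff Zy : Z (f.[th y] *: c y).
  by move/(subspace_predZ (f.[th y])^-1): Zy; rewrite scalerA mulVf // scale1r.
have := sumZ f size_f; rewrite (bigD1 (Ordinal (leyN : (y < N.+1)%N))) //= addrC.
apply: subspace_pred_addr; apply: subspace_pred_sum => k neq.
have lekN : (k <= N)%N by rewrite -ltnS.
have [kin | kout] := boolP (lo <= k < lo + m)%N; last exact/subspace_predZ/outZ.
have rk : val k \in r by rewrite mem_r kin lekN !andbT.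
suff -> : f.[th k] = 0 by rewrite scale0r; exact: Zsub.1.
by rewrite horner_prod (big_rem _ rk) /= hornerXsubC subrr mul0r.
Qed.

End SubspacePred.

(** Moves an operator from the vector to the subspace, so that a claim about a long word becomes one
    about its initial part. *)
Lemma subspace_pred_linear (F : fieldType) (V : lmodType F) (Z : V -> Prop)
    (f : {linear V -> V}) :
  subspace_pred Z -> subspace_pred (fun v => Z (f v)).
Proof.
by move=> [Z0 ZD]; split=> [|a v w]; rewrite ?linear0 ?linearP //; exact: ZD.
Qed.

(** * Reduction of words to nested words *)

(* A word is stored with its last letter first; the first letter is thus the most *)
(* significant one for this lexicographic order.                                  *)
Fixpoint wider (t s : seq nat) : bool :=
  match t, s with
  | x :: t', y :: s' => wider t' s' || (t' == s') && (x < y)%N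
  | _, _ => false
  end.

(* With x_0 = x_{-1} = 0 supplied by the default of head, this requires           *)
(* x_k + x_{k-1} <= N and x_{k-2} <= x_k. Indices at odd positions are reversed   *)
(* (x stands for N - x): in the original indices each letter lies between its two *)
(* predecessors, and a wider word has its first differing letter farther out.     *)
Fixpoint nested (N : nat) (s : seq nat) : bool :=
  if s is x :: s' then
    [&& (x + head 0 s' <= N)%N, (head 0 (behead s') <= x)%N & nested N s']
  else true.

(** A numeral in base [N.+1] whose units digit is the head: the termination measure that turns
    [wider] into the order of the naturals. *)
Definition word_code (N : nat) : seq nat -> nat :=
  foldr (fun x m => m * N.+1 + x)%N 0%N.

Lemma wider_code N t s :
  all (leq^~ N) t -> wider t s -> (word_code N t < word_code N s)%N.
Proof.
elim: t s => [|x t IH] [|y s] //= /andP[lex allt] /orP[/(IH _ allt)|/andP[/eqP-> ltxy]].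
  by rewrite /word_code /=; nia.
by rewrite /word_code /= ltn_add2l.
Qed.

Lemma wider_cat l t s : wider t s -> wider (l ++ t) (l ++ s).
Proof. by move=> ts; elim: l => //= x l ->. Qed.

Lemma nested_le N s : nested N s -> all (leq^~ N) s.
Proof.
elim: s => //= x s IH /and3P[lex _ /IH ->]; rewrite andbT.
by apply: leq_trans lex; exact: leq_addr.
Qed.

Section Words.
Variables (F : fieldType) (V : lmodType F) (N : nat).
Variables (P : bool -> nat -> {linear V -> V}) (th : bool -> nat -> F) (u : V).

(** The two families of operators alternate, chosen by the parity of the number of letters already
    applied. *)
Fixpoint word (s : seq nat) : V :=
  if s is x :: s' then P (odd (size s')) x (word s') else u.

Hypothesis th_inj : forall b, {in [pred i | (i <= N)%N] &, injective (th b)}.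
(** Here z and [head 0 s] are the neighbours of the letter y, and the two truncated differences add
    up to their distance. For empty s the default 0 stands, in the application, for the sphere on
    which u lies. *)
Hypothesis word_rel : forall (s : seq nat) (z : nat) (f : {poly F}),
  all (leq^~ N) s -> (z <= N)%N ->
  (size f <= (z - head 0 s) + (head 0 s - z))%N ->
  \sum_(y < N.+1) f.[th (odd (size s)) y] *: word [:: z, val y & s] = 0.

(** The pullback of Z along the prefix l. The length n is fixed because it decides the families of
    the letters of l. *)
Lemma word_catP (l : seq nat) (n : nat) (Z : V -> Prop) :
  subspace_pred Z ->
  exists2 Z', subspace_pred Z' &
    forall t, size t = n -> Z' (word t) <-> Z (word (l ++ t)).
Proof.
elim: l Z => [|x l IH] Z Zsub; first by exists Z.
have [Z' Z'sub Z'E] := IH _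
  (subspace_pred_linear (P (odd (size l + n)) x) Zsub).
by exists Z' => // t st; rewrite Z'E //= size_cat st.
Qed.

(* If y' replaces the last letter y of s, then either y' < y, which is wider, or  *)
(* y' overshoots in turn, or y' lies in an interval short enough to interpolate.  *)
Lemma word_overshoot (s : seq nat) (x : nat) (Z : V -> Prop) :
  subspace_pred Z -> nested N s -> (x <= N)%N -> (N < x + head 0 s)%N ->
  (forall t, size t = size s -> all (leq^~ N) t -> wider t s ->
     Z (word (x :: t))) ->
  Z (word (x :: s)).
Proof.
elim: s x Z => [|y s IH] x Z Zsub; first by rewrite /= addn0 ltnNge => _ ->.
move=> nest_s lexN ltNxy Zwider.
have /and3P[leN _ nest_s'] : nested N (y :: s) := nest_s.
have all_s := nested_le nest_s'.
apply: (@vandermonde_subspace _ _ Z Zsub N y (x - head 0 s) (th (odd (size s)))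
          (fun y => word [:: x, y & s])).
- exact: th_inj.
- move=> f size_f; rewrite word_rel //; first exact: Zsub.1.
  exact: leq_trans size_f (leq_addr _ _).
- move=> y' ley'N; rewrite negb_and -!ltnNge /= in ltNxy *.
  case/orP=> [lty' | lty']; first by apply: (Zwider (y' :: s)); rewrite //= ?ley'N // eqxx lty' orbT.
  (* Past the interval, [y' + head 0 s >= x + y > N], so [y'] overshoots the shorter word. *)
  apply: (IH y' (fun v => Z (P (~~ odd (size s)) x v))) => //.
  + exact: subspace_pred_linear.
  + by move: ltNxy lty' leN; move: (head 0%N s) => h; lia.
  move=> t st allt wts; have := Zwider (y' :: t); rewrite /= st; apply=> //.
    by rewrite ley'N.
  by rewrite wts.
- by move: leN; lia.
Qed.

(* Vary the last two letters y' and z' of s. For y' < a the shorter word already  *)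
(* undershoots. For y' >= a, by descending induction on y', the relation in y'    *)
(* disposes of all z' >= z + (y' - a), z' < z is wider, and the y' - a remaining  *)
(* values of z' are eliminated by the relation in z'.                             *)
Lemma word_undershoot (s : seq nat) (x : nat) (Z : V -> Prop) :
  subspace_pred Z -> nested N s -> (x < head 0 (behead s))%N ->
  (forall t, size t = size s -> all (leq^~ N) t -> wider t s ->
     Z (word (x :: t))) ->
  Z (word (x :: s)).
Proof.
have [n] := ubnP (size s); elim: n => // n IHn in s x Z *.
case: s => [|y [|z s]] //= size_s Zsub.
set a := head 0 s; move=> /and3P[leyz lea_y /and3P[leza lez nest_s]] ltxz Zwider.
have all_s := nested_le nest_s.
pose c z' y' := word [:: x, y', z' & s].
have c_lt z' y' : (z' < z)%N -> (y' <= N)%N -> Z (c z' y').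
  move=> ltz' ley'; apply: (Zwider [:: y', z' & s]) => //=; last by rewrite eqxx ltz' orbT.
  by rewrite ley' all_s andbT (leq_trans (ltnW ltz')) // (leq_trans _ leza) ?leq_addr.
have c_wide t z' y' : size t = size s -> all (leq^~ N) t -> wider t s ->
    (z' <= N)%N -> (y' <= N)%N -> Z (word [:: x, y', z' & t]).
  by move=> st allt wts lez' ley'; apply: (Zwider [:: y', z' & t]); rewrite /= ?st ?wts ?lez' ?ley'.
have c_over z' y' : (z' <= N)%N -> (y' <= N)%N -> (N < z' + a)%N -> Z (c z' y').
  move=> lez' ley' ltN.
  have [Z' Z'sub Z'E] := word_catP [:: x; y'] (size s).+1 Zsub.
  apply/(Z'E (z' :: s)) => //; apply: word_overshoot => // t st allt wts.
  by apply/(Z'E (z' :: t)); [rewrite /= st | exact: c_wide].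
have c_low z' y' : (z' <= N)%N -> (y' < a)%N -> Z (c z' y').
  elim/ltn_ind: z' => z' IHz lez' lty'a.
  have ley' : (y' <= N)%N by move: lty'a leza; lia.
  have [ltz'|lezz'] := ltnP z' z; first exact: c_lt.
  have [ltN|leN] := ltnP N (z' + a); first exact: c_over.
  have [Z' Z'sub Z'E] := word_catP [:: x] (size s).+2 Zsub.
  apply/(Z'E [:: y', z' & s]) => //; apply: IHn => //=.
    by rewrite leN (leq_trans lez lezz') nest_s.
  case=> [|z'' t] // [st] /andP[lez'' allt] ww.
  apply/(Z'E [:: y', z'' & t]); first by rewrite /= st.
  case/orP: ww => [wts|/andP[/eqP-> ltz'']]; first exact: c_wide.
  exact: IHz.
suff c_high m z' y' : (N - y' < m)%N -> (z' <= N)%N -> (y' <= N)%N -> (a <= y')%N ->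
    Z (c z' y').
  by apply: (c_high (N - y).+1); move: leyz leza; lia.
elim: m z' y' => // m IHm z' y' ltm lez' ley' leay'.
pose cz z := c z y'.
apply: (@vandermonde_subspace _ _ Z Zsub N z (y' - a) (th (odd (size s))) cz) => //.
  move=> f size_f.
  have: \sum_(z0 < N.+1) f.[th (odd (size s)) z0] *: word [:: y', val z0 & s] = 0.
    by apply: word_rel => //; apply: leq_trans size_f (leq_addr _ _).
  move=> /(congr1 (P (odd (size s).+2) x)); rewrite linear0 linear_sum /= => e.
  rewrite (eq_bigr (fun i : 'I_N.+1 => P (~~ ~~ odd (size s)) x
     (f.[th (odd (size s)) i] *: word [:: y', val i & s]))) ?e; first exact: Zsub.1.
  by move=> i _; rewrite linearZ.
move=> {lez'} {}z' lez'; rewrite negb_and -!ltnNge => /orP[lt|lt].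
  exact: c_lt.
(* Since [x < z] and [z' >= z + (y' - a)], the neighbours x and z' are far enough apart for this f.
   Its roots remove the letters from a to [y' - 1]; [c_low] handles those below a, and the induction
   those above [y']. *)
pose f : {poly F} := \prod_(k <- iota a (y' - a)) ('X - (th (~~ odd (size s)) k)%:P).
have := word_rel (s := z' :: s) (z := x) (f := f); rewrite /= lez' all_s.
rewrite size_prod_XsubC size_iota => rel.
have {rel} : \sum_(y0 < N.+1) f.[th (~~ odd (size s)) y0] *: c z' y0 = 0.
  by apply: rel => //; move: lt ltxz leza; lia.
rewrite (bigD1 (Ordinal (ley' : (y' < N.+1)%N))) //= addrC.
set rest := \sum_(i < _ | _) _ => sum0.
have Zrest : Z rest.
  apply: subspace_pred_sum => // k nek; have lekN : (k <= N)%N by rewrite -ltnS.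
  have [lta|leak] := ltnP k a; first by apply: subspace_predZ => //; exact: c_low.
  have [ltk|lek] := ltnP y' k; first by apply: subspace_predZ => //; apply: IHm => //; move: ltk ltm lekN; lia.
  have kin : val k \in iota a (y' - a).
    by rewrite mem_iota leak subnKC // ltn_neqAle lek andbT; exact: nek.
  by rewrite /f horner_prod (big_rem _ kin) /= hornerXsubC subrr mul0r scale0r; exact: Zsub.1.
have fy0 : f.[th (~~ odd (size s)) y'] != 0.
  rewrite horner_prod prodf_seq_neq0; apply/allP => k; rewrite mem_iota subnKC // => /andP[_ ltk] /=.
  have lekN : (k <= N)%N := leq_trans (ltnW ltk) ley'.
  rewrite hornerXsubC subr_eq0; apply: contraNneq (negbT (gtn_eqF ltk)) => eq_th.
  by rewrite (th_inj _ _ eq_th).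
have : Z (f.[th (~~ odd (size s)) y'] *: c z' y').
  by apply: (subspace_pred_addr Zsub Zrest); rewrite sum0; exact: Zsub.1.
by move/(subspace_predZ Zsub (f.[th (~~ odd (size s)) y'])^-1); rewrite scalerA mulVf // scale1r.
Qed.

(** A word that is not nested has a suffix [x :: s'] with [s'] nested whose head x overshoots or
    undershoots; either way it reduces to words of smaller [word_code]. *)
Lemma word_nested_span (s : seq nat) (Z : V -> Prop) :
  subspace_pred Z -> all (leq^~ N) s ->
  (forall t, size t = size s -> nested N t -> Z (word t)) -> Z (word s).
Proof.
move=> Zsub + Znest.
have [m] := ubnP (word_code N s); elim: m => // m IHm in s Znest *.
move=> lt_m all_s; have [nest_s|not_nested] := boolP (nested N s); first exact: Znest.
have [l [x [s' [def_s nest_s' nnest]]]] : exists l x s',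
    [/\ s = l ++ x :: s', nested N s' & ~~ nested N (x :: s')].
  elim: s not_nested {lt_m Znest all_s} => // x s IHs.
  have [nest_s nnest|/IHs[l [y [s' [-> ? ?]]]] _] := boolP (nested N s).
    by exists [::], x, s.
  by exists (x :: l), y, s'.
move: all_s; rewrite def_s all_cat => /andP[all_l /andP[lex all_s']].
have [Z' Z'sub Z'E] := word_catP l (size s').+1 Zsub.
apply/Z'E => //.
have Zwider t : size t = size s' -> all (leq^~ N) t -> wider t s' -> Z' (word (x :: t)).
  move=> st allt wts; apply/Z'E; rewrite /= ?st //.
  have all_t : all (leq^~ N) (l ++ x :: t) by rewrite all_cat all_l /= lex.
  apply: IHm => //.
    by move=> t' st' /Znest; apply; rewrite st' def_s !size_cat /= st.
  rewrite (leq_trans _ (lt_m : (word_code N s <= m)%N)) // def_s; apply: wider_code => //.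
  by apply: wider_cat; rewrite /= wts.
move: nnest; rewrite /= !negb_and -!ltnNge nest_s' orbF => /orP[lt|lt].
  exact: word_overshoot.
exact: word_undershoot.
Qed.

End Words.

(** * Symmetric real matrices *)

Section Spectral.
Variable R : realType.
Implicit Types n : nat.

Definition dotc n (u v : 'cV[R]_n) : R := (u^T *m v) 0 0.

Lemma dotc_eq0 n (u : 'cV[R]_n) : dotc u u = 0 -> u = 0.
Proof.
rewrite /dotc mxE => /psumr_eq0P uu0; apply/matrixP => i j; rewrite ord1 mxE.
have := uu0 _ i isT; rewrite mxE => uu_i.
by apply/eqP; rewrite -sqrf_eq0 expr2 uu_i // => k _; rewrite mxE -expr2 sqr_ge0.
Qed.

Lemma dotc_adj n (M : 'M[R]_n) (u v : 'cV[R]_n) :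
  dotc (M *m u) v = dotc u (M^T *m v).
Proof. by rewrite /dotc trmx_mul mulmxA. Qed.

Local Notation toC := (real_complex R).

Lemma symmetric_eigenvalue_real n (M : 'M[R]_n) (z : R[i]) :
  M^T = M -> eigenvalue (map_mx toC M) z -> exists a, z = toC a.
Proof.
move=> symM /eigenvalueP[v vM v0].
pose vs : 'cV[R[i]]_n := map_mx conjc v^T.
have Mvs : map_mx toC M *m vs = conjc z *: vs.
  have := congr1 (fun w : 'rV_n => map_mx conjc w^T) vM.
  rewrite trmx_mul map_mxM linearZ map_mxZ /= => <-; congr (_ *m _).
  by apply/matrixP => i j; rewrite !mxE -{1}symM mxE conjc_real.
have vvs : (v *m vs) 0 0 != 0.
  apply: contraNneq v0; rewrite mxE => /psumr_eq0P vv0; apply/eqP/rowP => i.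
  have := vv0 _ i isT; rewrite !mxE => /(_ _)/eqP; rewrite mulf_eq0 conjc_eq0 orbb => vi.
  by apply/eqP/vi => k _; rewrite !mxE mulcJ_ge0.
have : z *: (v *m vs) = conjc z *: (v *m vs).
  by rewrite scalemxAl -vM -mulmxA Mvs scalemxAr.
move=> /matrixP/(_ 0 0); rewrite mxE [in RHS]mxE => /(mulIf vvs).
case: z {vM Mvs} => a b /= [] /eqP; rewrite -subr_eq0 opprK => /eqP b0.
by exists a; rewrite /real_complex_def; congr Complex; lra.
Qed.

Lemma symmetric_char_poly_split n (M : 'M[R]_n) : (0 < n)%N ->
  M^T = M -> exists s : seq R, char_poly M = \prod_(a <- s) ('X - a%:P).
Proof.
move=> n_gt0 symM.
have [r def_r] := closed_field_poly_normal (char_poly (map_mx toC M)).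
rewrite (monicP (char_poly_monic _)) scale1r in def_r.
have [s def_s] : exists s : seq R, r = map toC s.
  have : all (fun z => eigenvalue (map_mx toC M) z) r.
    by apply/allP => z zr; rewrite eigenvalue_root_char def_r root_prod_XsubC.
  elim: r {def_r} => [|z r IH] /=; first by exists [::].
  case/andP => /(symmetric_eigenvalue_real symM)[a ->] /IH[s ->].
  by exists (a :: s).
exists s; apply: (map_poly_inj toC); rewrite map_char_poly def_r def_s big_map.
by rewrite rmorph_prod; apply: eq_bigr => a _; rewrite rmorphB /= map_polyX map_polyC.
Qed.

(** Apply the factors M - a of the split characteristic polynomial to v one by one. By
    Cayley-Hamilton the result eventually vanishes, and the last nonzero vector is an eigenvector,
    still in U. *)
Lemma symmetric_eigenvector n (M : 'M[R]_n) (U : 'cV[R]_n -> Prop) (v : 'cV[R]_n) :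
  M^T = M -> subspace_pred U -> (forall w, U w -> U (M *m w)) -> U v -> v != 0 ->
  exists a w, [/\ U w, w != 0 & M *m w = a *: w].
Proof.
case: n => [|n] in M U v *; first by rewrite [v]flatmx0 eqxx.
move=> symM Usub UM Uv v0.
have [s def_s] := symmetric_char_poly_split (ltn0Sn n) symM.
have := congr1 (mulmx^~ v) (Cayley_Hamilton M); rewrite def_s mul0mx.
elim: s v Uv v0 {def_s} => [|a s IH] v Uv v0.
  by rewrite big_nil rmorph1 mul1mx => /eqP; rewrite (negPf v0).
rewrite big_cons mulrC rmorphM /= -mulmxE -mulmxA rmorphB /= horner_mx_X horner_mx_C.
rewrite mulmxBl mul_scalar_mx.
have [Mv|nz] := eqVneq (M *m v - a *: v) 0; first by exists a, v; split=> //; exact: subr0_eq.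
apply: IH => //; apply: subspace_predD => //; first exact: UM.
by rewrite -scaleNr; exact: subspace_predZ.
Qed.

(** Each step passes to an eigenspace inside U, which the other operators preserve. Commutation is
    asked on U only, since the compressions are shown to commute only on the bottom sphere. *)
Lemma common_symmetric_eigenvector n (I : eqType) (s : seq I) (M : I -> 'M[R]_n)
    (U : 'cV[R]_n -> Prop) (v : 'cV[R]_n) :
  (forall i, (M i)^T = M i) -> subspace_pred U ->
  (forall i w, U w -> U (M i *m w)) ->
  (forall i j w, U w -> M i *m (M j *m w) = M j *m (M i *m w)) ->
  U v -> v != 0 ->
  exists w, [/\ U w, w != 0 & forall i, i \in s -> exists a, M i *m w = a *: w].
Proof.
move=> symM; elim: s => [|i s IH] in U v * => Usub UM Ucomm Uv v0; first by exists v.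
have [a [w [Uw w0 Mw]]] := symmetric_eigenvector (symM i) Usub (UM i) Uv v0.
pose U' u := U u /\ M i *m u = a *: u.
have [|||||x [[Ux Mx] x0 xs]] := IH U' w.
- split=> [|b x y [Ux Mx] [Uy My]]; first by split; rewrite ?mulmx0 ?scaler0 //; exact: Usub.1.
  split; first exact: Usub.2.
  by rewrite mulmxDr -scalemxAr Mx My scalerDr !scalerA mulrC.
- by move=> j u [Uu Mu]; split; [exact: UM | rewrite Ucomm // Mu scalemxAr].
- by move=> j k u [Uu _]; exact: Ucomm.
- by [].
- by [].
exists x; split=> // j; rewrite inE => /orP[/eqP->|/xs//]; by exists a.
Qed.

End Spectral.

(** * Tridiagonal families *)

(** A subspace of maximal dimension inside Z absorbs every further vector of Z. *)
Lemma subspace_pred_vspace (F : fieldType) (V : vectType F) (Z : V -> Prop) :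
  subspace_pred Z -> exists U : {vspace V}, forall v, v \in U <-> Z v.
Proof.
move=> Zsub; pose dimZ k := `[< exists U : {vspace V}, \dim U = k /\ forall v, v \in U -> Z v >].
have dimZ_ex : exists k, dimZ k.
  exists 0%N; apply/asboolP; exists 0%VS; rewrite dimv0; split=> // v.
  by rewrite memv0 => /eqP->; exact: Zsub.1.
have dimZ_le k : dimZ k -> (k <= \dim {:V})%N.
  by move/asboolP => [U [<- _]]; rewrite dimvS // subvf.
have [k /asboolP[U [dimU UZ]] kmax] := ex_maxnP dimZ_ex dimZ_le.
exists U => v; split=> [/UZ //|Zv]; have: dimZ (\dim (U + <[v]>)).
  apply/asboolP; exists (U + <[v]>)%VS; split=> // w /memv_addP[x xU [y /vlineP[a ->] ->]].
  by rewrite addrC; apply: Zsub.2 => //; exact: UZ.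
move/kmax; rewrite -dimU => le_dim.
have /eqP -> : (U == U + <[v]>)%VS by rewrite eqEdim addvSl.
by apply: (subvP (addvSr _ _)); exact: memv_line.
Qed.

Section TridiagonalFamily.
Variables (R : fieldType) (n D : nat) (B : 'M[R]_n) (F G : nat -> 'M[R]_n).
Variable eta : nat -> R.
Hypothesis F_sum : \sum_(i < D.+1) F i = 1%:M.
Hypothesis F_orth : forall i j, (i <= D)%N -> (j <= D)%N -> i != j ->
  F i *m F j = 0.
Hypothesis F_tri : forall i j, (i <= D)%N -> (j <= D)%N ->
  (1 < (i - j) + (j - i))%N -> F i *m B *m F j = 0.
Hypothesis G_sum : \sum_(i < D.+1) G i = 1%:M.
Hypothesis G_eigen : forall i, (i <= D)%N -> B *m G i = eta i *: G i.

Lemma tridiagonal_pow k i j : (i <= D)%N -> (j <= D)%N ->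
  (k < (i - j) + (j - i))%N -> F i *m B ^+ k *m F j = 0.
Proof.
elim: k j => [|k IH] j leiD lejD lt_k.
  rewrite expr0 mulmx1 F_orth //; apply: contraTneq lt_k => ->; lia.
have -> : B ^+ k.+1 = B ^+ k *m (\sum_(i < D.+1) F i) *m B by rewrite F_sum mulmx1 exprSr.
rewrite mulmx_sumr mulmx_suml mulmx_sumr mulmx_suml.
apply: big1 => h _; have lehD : (h <= D)%N by rewrite -ltnS.
have [ltk|lek] := ltnP k ((i - h) + (h - i)).
  by rewrite !mulmxA (IH h) // !mul0mx.
by rewrite -!mulmxA [F h *m (B *m F j)]mulmxA F_tri ?mulmx0 //; lia.
Qed.

Lemma pow_eigen_sum k : B ^+ k = \sum_(y < D.+1) eta y ^+ k *: G y.
Proof.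
elim: k => [|k IHk]; first by rewrite -[LHS]G_sum; apply: eq_bigr => y _; rewrite scale1r.
rewrite exprS IHk -mulmxE mulmx_sumr; apply: eq_bigr => y _.
by rewrite -scalemxAr G_eigen -1?ltnS // scalerA -exprSr.
Qed.

Lemma horner_eigen_sum (f : {poly R}) :
  \sum_(y < D.+1) f.[eta y] *: G y = \sum_(k < size f) f`_k *: B ^+ k.
Proof.
under [RHS]eq_bigr do rewrite pow_eigen_sum scaler_sumr.
rewrite exchange_big /=; apply: eq_bigr => y _.
by rewrite horner_coef scaler_suml; apply: eq_bigr => k _; rewrite scalerA.
Qed.

(** The sum of f(eta_y) G_y is f(B), and a polynomial in B of degree below |i - j| cannot connect
    F_i to F_j. It serves twice: with B = A between spheres, and with B = A* between eigenspaces. *)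
Lemma tridiagonal_horner i j (f : {poly R}) : (i <= D)%N -> (j <= D)%N ->
  (size f <= (i - j) + (j - i))%N ->
  \sum_(y < D.+1) f.[eta y] *: (F i *m G y *m F j) = 0.
Proof.
move=> leiD lejD size_f.
transitivity (F i *m (\sum_(y < D.+1) f.[eta y] *: G y) *m F j).
  rewrite mulmx_sumr mulmx_suml; apply: eq_bigr => y _.
  by rewrite -scalemxAr -scalemxAl.
rewrite horner_eigen_sum mulmx_sumr mulmx_suml; apply: big1 => k _.
rewrite -scalemxAr -scalemxAl tridiagonal_pow ?scaler0 //.
exact: leq_trans size_f.
Qed.

End TridiagonalFamily.

(** * The bottom sphere of a module *)

Section TridiagonalModule.
Variables (R : realType) (n D r : nat) (A As : 'M[R]_n) (E Es : nat -> 'M[R]_n).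
Variables (th ths : nat -> R) (W : {vspace 'cV[R]_n}).
Hypothesis th_inj : {in [pred i | (i <= D)%N] &, injective th}.
Hypothesis ths_inj : injective ths.
Hypothesis E_sum : \sum_(i < D.+1) E i = 1%:M.
Hypothesis Es_sum : \sum_(i < D.+1) Es i = 1%:M.
Hypothesis E_sym : forall i, (E i)^T = E i.
Hypothesis Es_sym : forall i, (Es i)^T = Es i.
Hypothesis E_mul : forall i j, (i <= D)%N -> (j <= D)%N ->
  E i *m E j = if i == j then E i else 0.
Hypothesis Es_mul : forall i j, Es i *m Es j = if i == j then Es i else 0.
Hypothesis Es_gt : forall i, (D < i)%N -> Es i = 0.
Hypothesis E_eigen : forall i, (i <= D)%N -> A *m E i = th i *: E i.
Hypothesis Es_eigen : forall i, (i <= D)%N -> As *m Es i = ths i *: Es i.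
Hypothesis E_tri : forall i j, (i <= D)%N -> (j <= D)%N ->
  (1 < (i - j) + (j - i))%N -> E i *m As *m E j = 0.
Hypothesis Es_tri : forall i j, (i <= D)%N -> (j <= D)%N ->
  (1 < (i - j) + (j - i))%N -> Es i *m A *m Es j = 0.
Hypothesis WA : forall v, v \in W -> A *m v \in W.
Hypothesis WEs : forall i v, v \in W -> Es i *m v \in W.
Hypothesis W_lt : forall i v, (i < r)%N -> v \in W -> Es i *m v = 0.

Lemma W_subspace : subspace_pred (fun v => v \in W).
Proof. by split=> [|a v w vW wW]; rewrite ?mem0v // memvD ?memvZ. Qed.

(** Every f(A) v lies in W, so interpolation at the D + 1 eigenvalues modulo W isolates E_i v. *)
Lemma W_idempotent i v : (i <= D)%N -> v \in W -> E i *m v \in W.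
Proof.
move=> leiD vW.
apply: (@vandermonde_subspace _ _ _ W_subspace D 0 D.+1 th (fun y => E y *m v)) => // [f _|y leyD].
  have -> : \sum_(y < D.+1) f.[th y] *: (E y *m v) = (\sum_(y < D.+1) f.[th y] *: E y) *m v.
    by rewrite mulmx_suml; apply: eq_bigr => y _; rewrite -scalemxAl.
  rewrite (horner_eigen_sum E_sum E_eigen) mulmx_suml memv_suml // => k _.
  rewrite -scalemxAl memvZ //; elim: (val k) => [|m IH]; first by rewrite mul1mx.
  by rewrite exprS -mulmxE -mulmxA WA.
by rewrite add0n ltnS leyD.
Qed.

Lemma E_word_rel a b (f : {poly R}) : (size f <= (a - b) + (b - a))%N ->
  \sum_(y < D.+1) f.[th y] *: (Es a *m (E y *m Es b)) = 0.
Proof.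
move=> size_f; have [ltDa|leaD] := ltnP D a.
  by apply: big1 => y _; rewrite Es_gt // mul0mx scaler0.
have [ltDb|lebD] := ltnP D b.
  by apply: big1 => y _; rewrite (Es_gt ltDb) !mulmx0 scaler0.
have Es_orth i j : (i <= D)%N -> (j <= D)%N -> i != j -> Es i *m Es j = 0.
  by move=> _ _ /negPf neq; rewrite Es_mul neq.
have := tridiagonal_horner Es_sum Es_orth Es_tri E_sum E_eigen leaD lebD size_f.
by move=> e; rewrite -[RHS]e; apply: eq_bigr => y _; rewrite mulmxA.
Qed.

(* The spheres at distance < r do not meet W, so the sum may start at r. *)
Lemma Es_word_rel i j (f : {poly R}) v : (i <= D)%N -> (j <= D)%N -> v \in W ->
  (size f <= (i - j) + (j - i))%N ->
  \sum_(y < D.+1) f.[ths (r + y)] *: (E i *m (Es (r + y) *m (E j *m v))) = 0.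
Proof.
move=> leiD lejD vW size_f; pose g s := f.[ths s] *: (E i *m (Es s *m (E j *m v))).
have E_orth h k : (h <= D)%N -> (k <= D)%N -> h != k -> E h *m E k = 0.
  by move=> leh lek /negPf neq; rewrite E_mul // neq.
have := tridiagonal_horner E_sum E_orth E_tri Es_sum Es_eigen leiD lejD size_f.
move/(congr1 (mulmx^~ v)); rewrite mul0mx mulmx_suml => sum0.
have {}sum0 : \sum_(0 <= s < D.+1) g s = 0.
  by rewrite big_mkord -[RHS]sum0; apply: eq_bigr => s _; rewrite -scalemxAl /g !mulmxA.
rewrite -(big_mkord xpredT (fun y => g (r + y)%N)).
have -> : \sum_(0 <= y < D.+1) g (r + y)%N = \sum_(r <= s < D.+1 + r) g s.
  have := @big_addn _ 0%R +%R 0%N (D.+1 + r)%N r xpredT g; rewrite add0n addnK => ->.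
  by apply: eq_bigr => y _; rewrite addnC.
rewrite -[RHS]sum0; transitivity (\sum_(0 <= s < D.+1 + r) g s).
  rewrite [RHS](@big_cat_nat _ _ _ r) //= ?leq_addl // [X in _ = X + _]big1_seq ?add0r // => s /andP[_].
  by rewrite mem_index_iota /g => /andP[_ ltsr]; rewrite W_lt ?W_idempotent // mulmx0 scaler0.
rewrite (@big_cat_nat _ _ _ D.+1) //= ?leq_addr // [X in _ + X]big1_seq ?addr0 // => s /andP[_].
by rewrite mem_index_iota /g => /andP[ltDs _]; rewrite Es_gt // mul0mx mulmx0 scaler0.
Qed.

(* By descending induction on s, the antisymmetric part vanishes for |i - j| > s  *)
(* and kills the polynomials of degree < s in either index; its rows then vanish  *)
(* one after the other.                                                           *)
Lemma word_bilinear_sym (u v : 'cV[R]_n) s i j : Es r *m u = u -> Es r *m v = v ->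
  v \in W -> (s <= D)%N -> (i <= D)%N -> (j <= D)%N ->
  dotc (E i *m u) (Es (r + s) *m (E j *m v)) =
  dotc (E j *m u) (Es (r + s) *m (E i *m v)).
Proof.
move=> Eu Ev vW.
pose F s i j := dotc (E i *m u) (Es (r + s) *m (E j *m v)).
(* [R^o] is the field as a module over itself, so that [vandermonde_subspace] applies to the entries
   of H. *)
pose H s i j : R^o := F s i j - F s j i.
have HN t h k : H t h k = - H t k h by rewrite /H opprB.
suff H0 : forall m t h k, (D - t < m)%N -> (t <= D)%N -> (h <= D)%N -> (k <= D)%N -> H t h k = 0.
  by move=> les lei lej; apply/subr0_eq/(H0 (D - s).+1 s i j).
have dotc_sumr (w : 'cV[R]_n) (c : 'I_D.+1 -> R) (x : 'I_D.+1 -> 'cV_n) :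
    \sum_y c y * dotc w (x y) = dotc w (\sum_y c y *: x y).
  rewrite /dotc mulmx_sumr summxE; apply: eq_bigr => y _.
  by rewrite -scalemxAr [in RHS]mxE.
have dotc_suml (w : 'cV[R]_n) (c : 'I_D.+1 -> R) (x : 'I_D.+1 -> 'cV_n) :
    \sum_y c y * dotc (x y) w = dotc (\sum_y c y *: x y) w.
  rewrite /dotc linear_sum mulmx_suml summxE; apply: eq_bigr => y _.
  by rewrite linearZ /= -scalemxAl [in RHS]mxE.
have dotc0r w : @dotc R n w 0 = 0 by rewrite /dotc mulmx0 mxE.
have dotc0l w : @dotc R n 0 w = 0 by rewrite /dotc trmx0 mul0mx mxE.
have band h k (f : {poly R}) : (h <= D)%N -> (k <= D)%N ->
    (size f <= (h - k) + (k - h))%N ->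
    \sum_(y < D.+1) f.[ths (r + y)] * H y h k = 0.
  move=> leh lek size_f.
  have F0 h' k' : (h' <= D)%N -> (k' <= D)%N -> (size f <= (h' - k') + (k' - h'))%N ->
      \sum_(y < D.+1) f.[ths (r + y)] * F y h' k' = 0.
    move=> leh' lek' size'; rewrite -[RHS](dotc0r u) -(Es_word_rel leh' lek' vW size').
    rewrite -dotc_sumr; apply: eq_bigr => y _; by rewrite /F dotc_adj E_sym.
  under eq_bigr do rewrite mulrBr.
  by rewrite sumrB !F0 ?subrr // addnC.
have kill t h (f : {poly R}) : (size f <= t)%N ->
    \sum_(y < D.+1) f.[th y] * H t h y = 0.
  move=> size_f; under eq_bigr do rewrite mulrBr.
  have rel w : Es r *m w = w -> \sum_(y < D.+1) f.[th y] *: (Es (r + t) *m (E y *m w)) = 0.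
    move=> Ew; have := @E_word_rel (r + t) r f; rewrite addKn subnDA subnn sub0n addn0.
    move=> /(_ size_f)/(congr1 (mulmx^~ w)); rewrite mul0mx => e; rewrite -[RHS]e mulmx_suml.
    by apply: eq_bigr => y _; rewrite -scalemxAl -!mulmxA Ew.
  rewrite sumrB dotc_sumr rel // dotc0r sub0r.
  under eq_bigr do rewrite /F -[Es (r + t)]Es_sym -dotc_adj.
  by rewrite dotc_suml rel // dotc0l oppr0.
elim=> // m IHm t h k ltm let_ leh lek.
have band_t i' j' : (i' <= D)%N -> (j' <= D)%N -> (t < (i' - j') + (j' - i'))%N -> H t i' j' = 0.
  move=> lei' lej' lt_t.
  (* The roots remove [y < t] and the outer induction removes [y > t], so only the coefficient at t
     remains. *)
  pose f : {poly R} := \prod_(k <- iota 0 t) ('X - (ths (r + k))%:P).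
  have := band i' j' f lei' lej'; rewrite size_prod_XsubC size_iota => /(_ lt_t).
  rewrite (bigD1 (Ordinal (let_ : (t < D.+1)%N))) //= big1 ?addr0 => [/eqP|y ney].
    rewrite mulf_eq0 => /orP[|/eqP//]; rewrite horner_prod prodf_seq_eq0 => /hasP[y].
    rewrite mem_iota /= hornerXsubC subr_eq0 => lty /eqP/ths_inj/addnI eq_ty.
    by rewrite eq_ty ltnn in lty.
  have [lty|ley] := ltnP y t.
    have yin : val y \in iota 0 t by rewrite mem_iota.
    by rewrite horner_prod (big_rem _ yin) /= hornerXsubC subrr mul0r mul0r.
  have neq : t != y by apply: contraNneq ney => eq_ty; apply/eqP/val_inj.
  have ltyD := ltn_ord y.
  by rewrite IHm ?mulr0 //; move: neq ley ltyD ltm; lia.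
elim/ltn_ind: h k leh lek => h IHh k leh lek.
have zero_sub : subspace_pred (fun x : R^o => x = 0).
  by split=> // a x y -> ->; rewrite scaler0 addr0.
(* In row h, antisymmetry and the earlier rows clear the columns up to h, and the band clears those
   past h + t. The t columns left satisfy the t moment conditions of [kill]. *)
apply: (@vandermonde_subspace _ _ _ zero_sub D h.+1 t th (H t h)) => //.
  exact: kill.
move=> j' lej'; rewrite negb_and -!ltnNge => /orP[lt|lt].
  have [<-|nej] := eqVneq h j'; first by rewrite /H subrr.
  by rewrite HN IHh ?oppr0 //; move: lt nej; lia.
by apply: band_t => //; move: lt; lia.
Qed.

Lemma sphere_eigenvector (v : 'cV[R]_n) : v \in W -> v != 0 -> Es r *m v = v ->
  exists u, [/\ u \in W, u != 0, Es r *m u = u &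
    forall i, (i <= D)%N -> exists a, Es r *m (E i *m u) = a *: u].
Proof.
move=> vW v0 Ev.
pose M (i : 'I_D.+1) := Es r *m E i *m Es r.
pose U (u : 'cV[R]_n) := u \in W /\ Es r *m u = u.
have MU (i : 'I_D.+1) w : Es r *m w = w -> M i *m w = Es r *m (E i *m w).
  by move=> Ew; rewrite /M -!mulmxA Ew.
have UM (i : 'I_D.+1) w : U w -> U (M i *m w).
  move=> [wW Ew]; rewrite MU //; split; first by rewrite WEs ?W_idempotent // -ltnS.
  by rewrite !mulmxA Es_mul eqxx.
have Usub : subspace_pred U.
  split=> [|a x y [xW Ex] [yW Ey]]; first by rewrite /U mem0v mulmx0.
  by split; [exact: W_subspace.2 | rewrite mulmxDr -scalemxAr Ex Ey].
have [||||||u [[uW Eu] u0 uM]] :=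
  @common_symmetric_eigenvector R n _ (enum 'I_D.+1) M U v.
- by move=> i; rewrite /M !trmx_mul Es_sym E_sym mulmxA.
- exact: Usub.
- exact: UM.
(* The commutator value x lies on the bottom sphere itself, so pairing it with itself brings in
   [word_bilinear_sym] at s = 0 and gives norm zero. *)
- move=> i j w [wW Ew]; apply/subr0_eq/dotc_eq0; set x := (_ - _).
  have [xW Ex] : U x.
    have [yW Ey] : U (M i *m (M j *m w)) by exact/UM/UM.
    have [zW Ez] : U (M j *m (M i *m w)) by exact/UM/UM.
    by split; [exact: memvB | rewrite mulmxBr Ey Ez].
  have MM (h k : 'I_D.+1) :
      dotc x (M h *m (M k *m w)) = dotc (E h *m x) (Es r *m (E k *m w)).
    have -> : M h *m (M k *m w) = Es r *m (E h *m (Es r *m (E k *m w))).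
      have [_ EM] : U (M k *m w) by exact: UM.
      by rewrite MU // MU.
    by rewrite [RHS]dotc_adj E_sym -[in RHS]Ex [RHS]dotc_adj Es_sym.
  have -> : dotc x x = dotc x (M i *m (M j *m w)) - dotc x (M j *m (M i *m w)).
    by rewrite {2}/x /dotc mulmxBr mxE [in X in _ + X]mxE.
  rewrite !MM.
  have := @word_bilinear_sym x w 0 i j Ex Ew wW (leq0n _); rewrite addn0 => ->.
  + by rewrite subrr.
  + by rewrite -ltnS.
  + by rewrite -ltnS.
- by [].
- by [].
exists u; split=> // i leiD.
have [a Ma] := uM (Ordinal (leiD : (i < D.+1)%N)) (mem_enum _ _).
by exists a; rewrite -Ma MU.
Qed.

(* The reversal D - x of the indices of the E_i makes the two parities symmetric. *)
Let P (b : bool) (x : nat) : {linear 'cV[R]_n -> 'cV[R]_n} :=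
  mulmx (if b then Es (r + x) else E (D - x)).
Let eta (b : bool) (x : nat) : R := if b then ths (r + x) else th (D - x).

(** * Words applied to the common eigenvector *)

Section FromEigenvector.
Variable u : 'cV[R]_n.
Hypothesis uW : u \in W.
Hypothesis Eu : Es r *m u = u.
Hypothesis u_eigen : forall i, (i <= D)%N -> exists a, Es r *m (E i *m u) = a *: u.

Local Notation wd := (word P u).

Lemma letter_mem b x v : v \in W -> P b x v \in W.
Proof. by case: b => vW; [exact: WEs | apply: W_idempotent; rewrite ?leq_subr]. Qed.

Lemma letter_mul b x y v : (x <= D)%N -> (y <= D)%N ->
  P b x (P b y v) = if x == y then P b y v else 0.
Proof.
move=> lex ley; case: b; rewrite /= mulmxA.
  by rewrite Es_mul eqn_add2l; case: eqVneq => [->|_]; rewrite ?mul0mx.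
rewrite E_mul ?leq_subr //.
have -> : (D - x == D - y)%N = (x == y) by apply/eqP/eqP; lia.
by case: eqVneq => [->|_]; rewrite ?mul0mx.
Qed.

Lemma word_mem s : wd s \in W.
Proof. by elim: s => //= x s IH; exact: letter_mem. Qed.

(** For the empty word this is u = E*_r u: u acts as if it began with the sphere letter 0, matching
    the default of [head]. *)
Lemma word_head s : exists2 v, v \in W & wd s = P (~~ odd (size s)) (head 0%N s) v.
Proof.
case: s => [|x s] /=; last by exists (wd s); rewrite ?word_mem ?negbK.
by exists u; rewrite //= addn0 Eu.
Qed.

Lemma letter_eigenvalue_inj b : {in [pred i | (i <= D)%N] &, injective (eta b)}.
Proof.
case: b => x y; rewrite !inE => lex ley; first by move/ths_inj/addnI.
by move/th_inj; rewrite !inE !leq_subr => /(_ isT isT); lia.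
Qed.

Lemma word_relP (s : seq nat) (z : nat) (f : {poly R}) :
  all (leq^~ D) s -> (z <= D)%N ->
  (size f <= (z - head 0 s) + (head 0 s - z))%N ->
  \sum_(y < D.+1) f.[eta (odd (size s)) y] *: wd [:: z, val y & s] = 0.
Proof.
move=> all_s lez size_f.
have leh : (head 0 s <= D)%N by case: (s) all_s => //= x s' /andP[].
have [v vW def_s] := word_head s.
rewrite /= def_s; case: (odd (size s)) => /=.
  apply: Es_word_rel; rewrite ?leq_subr //.
  by move: size_f lez leh; move: (head _ _) (size f) => h m; lia.
rewrite (reindex_inj rev_ord_inj) /=.
have := @E_word_rel (r + z) (r + head 0%N s) f; rewrite !subnDl => /(_ size_f).
move/(congr1 (mulmx^~ v)); rewrite mul0mx mulmx_suml => sum0; rewrite -[RHS]sum0.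
apply: eq_bigr => y _; rewrite -scalemxAl !mulmxA subSS subKn //.
by rewrite -ltnS.
Qed.

(** Nestedness bounds each letter below by the one two places earlier, so a final 0 forces every
    sphere letter to be 0, and the word is a product of compressions, each scaling u. *)
Lemma nested_even_word s : nested D s -> ~~ odd (size s) -> head 0%N s = 0%N ->
  exists a, wd s = a *: u.
Proof.
have [m] := ubnP (size s); elim: m => // m IHm in s *.
case: s => [|x [|y s]] //=; first by exists 1; rewrite scale1r.
rewrite !ltnS negbK => size_s /and4P[_ hx ley /andP[_ nest_s]] even_s x0.
have [||||a ->] := IHm s; [by apply: ltnW | by [] | by [] |..|].
  by move: hx; rewrite x0 leqn0 => /eqP.
rewrite even_s x0 addn0 /=; have [b Mb] := u_eigen (leq_subr y D).
by exists (a * b); rewrite (negPf even_s) /= -!scalemxAr Mb scalerA.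
Qed.

Lemma sphere_word s : all (leq^~ D) s -> exists a, Es r *m wd s = a *: u.
Proof.
(* A word of odd length ends with some E_i; prepending the letter 0 applies E*_r, which is
   idempotent. *)
move=> all_s; wlog even_s : s all_s / ~~ odd (size s).
  move=> IH; have [odd_s|] := boolP (odd (size s)); last exact: IH.
  have [] := IH (0%N :: s); rewrite //= ?odd_s // addn0 => a Ea.
  by exists a; rewrite -Ea mulmxA Es_mul eqxx.
pose Z v := exists a, Es r *m v = a *: u.
have Zsub : subspace_pred Z.
  split=> [|a v w [b Ev] [c Ew]]; first by exists 0; rewrite mulmx0 scale0r.
  by exists (a * b + c); rewrite mulmxDr -scalemxAr Ev Ew scalerDl scalerA.
apply: (word_nested_span letter_eigenvalue_inj word_relP Zsub all_s) => t st nest_t.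
have even_t : ~~ odd (size t) by rewrite st.
have [h0|hn0] := eqVneq (head 0%N t) 0%N.
  have [a ->] := nested_even_word nest_t even_t h0.
  by exists a; rewrite -scalemxAr Eu.
have [v _ ->] := word_head t; rewrite even_t /=.
exists 0; rewrite mulmxA Es_mul scale0r -{1}[r]addn0 eqn_add2l eq_sym (negPf hn0).
by rewrite mul0mx.
Qed.

Lemma sphere_line (v : 'cV[R]_n) :
  (forall U : {vspace 'cV[R]_n}, (U <= W)%VS -> u \in U ->
     (forall w, w \in U -> A *m w \in U) ->
     (forall i w, (i <= D)%N -> w \in U -> Es i *m w \in U) -> U = W) ->
  v \in W -> exists a, Es r *m v = a *: u.
Proof.
move=> irr vW.
(* The span of the words as the intersection of all subspaces containing them; choosing Z reduces
   claims on the span to single words. *)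
pose Sp w := forall Z : 'cV[R]_n -> Prop, subspace_pred Z ->
  (forall s, all (leq^~ D) s -> Z (wd s)) -> Z w.
have Spsub : subspace_pred Sp.
  split=> [Z Zsub _|a x y Sx Sy Z Zsub Zs]; first exact: Zsub.1.
  by apply: Zsub.2; [exact: Sx | exact: Sy].
have SpP b x w : (x <= D)%N -> Sp w -> Sp (P b x w).
  move=> lex Sw; apply: (Sw (fun w => Sp (P b x w))); first exact: subspace_pred_linear.
  move=> s all_s; have leh : (head 0 s <= D)%N by case: (s) all_s => //= y s' /andP[].
  have [->|neq] := eqVneq b (odd (size s)).
    by move=> Z _ Zs; apply: (Zs (x :: s)); rewrite /= lex all_s.
  (* The new letter belongs to the same family as the head, so orthogonality returns the word or
     0. *)
  have -> : b = ~~ odd (size s) by case: (b) (odd (size s)) neq => [] [].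
  have [y _ def_s] := word_head s; rewrite def_s letter_mul //.
  case: ifP => _; last exact: Spsub.1.
  by rewrite -def_s => Z _; apply.
have SpW w : Sp w -> w \in W.
  by move=> Sw; apply: (Sw (fun x => x \in W)); [exact: W_subspace | move=> s _; exact: word_mem].
have [U USp] := subspace_pred_vspace Spsub.
have UW : U = W.
  apply: irr; first by apply/subvP => w /USp/SpW.
  - by apply/USp => Z _ Zs; exact: (Zs [::]).
  - move=> w /USp Sw; apply/USp.
    have -> : A *m w = \sum_(i < D.+1) th i *: (E i *m w).
      rewrite -[A]mulmx1 -E_sum mulmx_sumr mulmx_suml; apply: eq_bigr => i _.
      by rewrite E_eigen -?scalemxAl // -ltnS.
    apply: (subspace_pred_sum Spsub) => i _; apply: (subspace_predZ Spsub).
    have leiD : (i <= D)%N by rewrite -ltnS.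
    by have := SpP false (D - i)%N w (leq_subr _ _) Sw; rewrite /= subKn.
  - move=> i w leiD /USp Sw; apply/USp.
    have [ltir|leri] := ltnP i r; first by rewrite W_lt ?SpW //; exact: Spsub.1.
    have := SpP true (i - r)%N w; rewrite /= subnKC //; apply=> //.
    exact: leq_trans (leq_subr _ _) leiD.
have Sv : Sp v by apply/USp; rewrite UW.
apply: (Sv (fun v => exists a, Es r *m v = a *: u)) => [|s all_s]; last exact: sphere_word.
split=> [|a x w [b Ev] [c Ew]]; first by exists 0; rewrite mulmx0 scale0r.
by exists (a * b + c); rewrite mulmxDr -scalemxAr Ev Ew scalerDl scalerA.
Qed.

End FromEigenvector.
End TridiagonalModule.

(** * Distances and powers of the adjacency matrix *)

Lemma mulmx_cV_eq0 (F : fieldType) m n (M : 'M[F]_(m, n)) :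
  (forall v : 'cV_n, M *m v = 0) -> M = 0.
Proof.
move=> M0; apply/matrixP => i j; rewrite [RHS]mxE.
by have /matrixP/(_ i 0) := M0 (delta_mx j 0); rewrite -colE !mxE.
Qed.

Section DistanceFacts.
Variables (R : realType) (X : finType) (e : rel X).
Hypothesis e_sym : symmetric e.
Hypothesis e_irr : irreflexive e.
Hypothesis e_conn : forall y z : X, connect e y z.

Local Notation A := (adjmx R e).
Local Notation D := (diameter e).

Definition walk (k : nat) (y z : X) : bool :=
  [exists p : k.-tuple X, path e y p && (last y p == z)].

Lemma walk0 y z : walk 0 y z = (y == z).
Proof.
apply/existsP/eqP => [[p]|->]; first by rewrite tuple0 => /andP[_ /eqP].
by exists [tuple]; rewrite /= eqxx.
Qed.

Lemma walkS k y z : walk k.+1 y z = [exists w, e y w && walk k w z].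
Proof.
apply/existsP/existsP => [[p]|[w /andP[eyw /existsP[p pP]]]].
  case: (tupleP p) => w q /= /andP[/andP[eyw eq] lq]; exists w; rewrite eyw /=.
  by apply/existsP; exists q; rewrite eq.
by exists (cons_tuple w p); rewrite /= eyw.
Qed.

Lemma adj_tr : A^T = A.
Proof. by apply/matrixP => i j; rewrite !mxE e_sym. Qed.

Lemma adj_pow_tr k : (A ^+ k)^T = A ^+ k.
Proof.
elim: k => [|k IH]; first by rewrite expr0 trmx1.
by rewrite {1}exprS -mulmxE trmx_mul IH adj_tr exprSr.
Qed.

Lemma adj_pow_ge0 k i j : 0 <= (A ^+ k) i j.
Proof.
elim: k i j => [|k IH] i j; first by rewrite expr0 mxE ler0n.
by rewrite exprS -mulmxE mxE sumr_ge0 // => h _; rewrite mulr_ge0 // mxE ler0n.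
Qed.

Lemma adj_pow_walk k i j : ((A ^+ k) i j != 0) = walk k (enum_val i) (enum_val j).
Proof.
elim: k i j => [|k IH] i j.
  by rewrite expr0 walk0 mxE (inj_eq enum_val_inj); case: (i == j); rewrite ?oner_eq0 ?eqxx.
rewrite exprS -mulmxE mxE walkS psumr_neq0; last first.
  by move=> h _; rewrite mulr_ge0 ?adj_pow_ge0 // mxE ler0n.
apply/hasP/existsP => [[h _ /= lt0]|[w /andP[eiw wk]]].
  exists (enum_val h); move: lt0; rewrite mxE -IH; case: (e _ _) => /= lt0.
    by apply: lt0r_neq0; rewrite mul1r in lt0.
  by rewrite mul0r ltxx in lt0.
exists (enum_rank w); first by rewrite mem_index_enum.
rewrite /= mxE enum_rankK eiw mul1r lt0r adj_pow_ge0 andbT IH.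
by rewrite enum_rankK.
Qed.

Lemma walk_sym k y z : walk k y z = walk k z y.
Proof.
rewrite -[y]enum_rankK -[z]enum_rankK -!adj_pow_walk -[in LHS]adj_pow_tr.
by rewrite mxE.
Qed.

Lemma gdistE y z : gdist e y z = find (fun k => walk k y z) (iota 0 #|X|).
Proof. by []. Qed.

Lemma walk_has y z : has (fun k => walk k y z) (iota 0 #|X|).
Proof.
have /connectP[p pP ->] := e_conn y z; case/shortenP: pP => q qP uq _.
apply/hasP; exists (size q).
  by rewrite mem_iota /= add0n -[(size q).+1]/(size (y :: q)) -(card_uniqP uq) max_card.
by apply/existsP; exists (in_tuple q); rewrite qP eqxx.
Qed.

Lemma walk_gdist y z : walk (gdist e y z) y z.
Proof.
have := nth_find 0%N (walk_has y z); rewrite -gdistE nth_iota ?add0n //.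
by rewrite gdistE -[X in (_ < X)%N](size_iota 0) -has_find walk_has.
Qed.

Lemma gdist_le k y z : walk k y z -> (gdist e y z <= k)%N.
Proof.
move=> wk; rewrite leqNgt; apply/negP => ltk.
have ltkX : (k < #|X|)%N.
  by apply: leq_trans ltk _; rewrite -[X in (_ <= X)%N](size_iota 0) gdistE find_size.
by rewrite gdistE in ltk; have := before_find 0%N ltk; rewrite nth_iota // add0n wk.
Qed.

Lemma gdist_sym y z : gdist e y z = gdist e z y.
Proof. by rewrite !gdistE; apply: eq_find => k; rewrite walk_sym. Qed.

Lemma gdist_step y w z : e y w -> (gdist e y z <= (gdist e w z).+1)%N.
Proof.
by move=> eyw; apply: gdist_le; rewrite walkS; apply/existsP; exists w; rewrite eyw walk_gdist.
Qed.

Lemma gdist_le_diameter y z : (gdist e y z <= D)%N.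
Proof.
by rewrite (leq_trans _ (leq_bigmax y)) //; exact: (leq_bigmax (F := gdist e y)).
Qed.

Lemma gdist1 y w : (gdist e y w == 1%N) = e y w.
Proof.
have w1 : walk 1 y w = e y w.
  rewrite walkS; apply/existsP/idP => [[z]|eyw]; first by rewrite walk0 => /andP[? /eqP<-].
  by exists w; rewrite eyw walk0 eqxx.
apply/eqP/idP => [d1|eyw]; first by rewrite -w1 -d1 walk_gdist.
have := gdist_le (k := 1) (y := y) (z := w); rewrite w1 => /(_ eyw).
case: (gdist e y w) (walk_gdist y w) => [|[|//]] //.
by rewrite walk0 => /eqP eqyw; rewrite eqyw e_irr in eyw.
Qed.

Definition index_dist (i j : 'I_#|X|) : nat := gdist e (enum_val i) (enum_val j).

(** The distance is the least k for which the entry of A^k is nonzero. *)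
Lemma index_dist_eq_of_adj_pow i j i' j' :
  (forall k, (A ^+ k) i j = (A ^+ k) i' j') -> index_dist i j = index_dist i' j'.
Proof.
by move=> eqA; rewrite /index_dist !gdistE; apply: eq_find => k; rewrite -!adj_pow_walk eqA.
Qed.

Lemma adj_pow_index_dist k i j i' j' : (1 <= D)%N -> distance_regular e ->
  index_dist i j = index_dist i' j' -> (A ^+ k) i j = (A ^+ k) i' j'.
Proof.
move=> D_ge1 e_dr.
suff [c cE] : exists c : nat -> R, forall i j, (A ^+ k) i j = c (index_dist i j).
  by move=> eq_d; rewrite !cE eq_d.
elim: k {i j i' j'} => [|k [c IH]].
  exists (fun d => (d == 0%N)%:R) => i j; rewrite expr0 mxE -(inj_eq enum_val_inj) -walk0.
  have <- : (index_dist i j == 0%N) = walk 0 (enum_val i) (enum_val j); last by [].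
  apply/eqP/idP => [d0|/gdist_le]; first by rewrite -d0 walk_gdist.
  by rewrite leqn0 => /eqP.
pose S (i j : 'I_#|X|) : R := \sum_(h < D.+1) c h *
  #|[set w | (gdist e (enum_val i) w == 1%N) && (gdist e (enum_val j) w == h)]|%:R.
have powS i j : (A ^+ k.+1) i j = S i j.
  rewrite exprS -mulmxE mxE (eq_bigr (fun w => \sum_(h < D.+1)
    c h * ((index_dist i w == 1%N) && (index_dist j w == h))%:R)); last first.
    move=> w _; have ltD : (index_dist j w < D.+1)%N by rewrite ltnS gdist_le_diameter.
    rewrite (bigD1 (Ordinal ltD)) //= eqxx andbT big1 ?addr0 => [|h neq].
      by rewrite mxE -gdist1 IH mulrC [index_dist w j]gdist_sym.
    by rewrite [_ == val h]eq_sym -[val h == _]/(h == Ordinal ltD) (negPf neq) andbF mulr0.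
  rewrite exchange_big; apply: eq_bigr => h _ /=; rewrite -mulr_sumr; congr (_ * _).
  rewrite -natr_sum; congr _%:R.
  rewrite -sum1dep_card [RHS]big_mkcond /= [RHS](reindex_onto enum_val enum_rank) /=; last first.
    by move=> w _; rewrite enum_rankK.
  by apply: eq_big => [w|w _]; rewrite ?enum_valK ?eqxx // /index_dist; case: (_ && _).
have Seq i j i' j' : index_dist i j = index_dist i' j' -> S i j = S i' j'.
  move=> eq_d; apply: eq_bigr => h _; congr (_ * _%:R).
  have ltD : (index_dist i j < D.+1)%N by rewrite ltnS gdist_le_diameter.
  (* The count is an intersection number with an index 1, legitimate since [D_ge1] holds. *)
  exact: (e_dr (Ordinal ltD) (Ordinal (D_ge1 : (1 < D.+1)%N)) h).
exists (fun d => if [pick p : 'I_#|X| * 'I_#|X| | index_dist p.1 p.2 == d] is Some p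
                 then S p.1 p.2 else 0) => i j.
rewrite powS; case: pickP => [[a b] /= /eqP eq_d|/(_ (i, j))/=]; last by rewrite eqxx.
by rewrite (Seq _ _ _ _ eq_d).
Qed.

(** * Projections onto the spheres around a vertex *)

Section DualIdempotents.
Variable y : X.
Local Notation Es := (dual_idempotent R e y).

Lemma dual_idempotent_entry i a b :
  Es i a b = ((a == b) && (gdist e y (enum_val a) == i))%:R.
Proof.
by rewrite !mxE; case: (eqVneq a b) => [->|_]; rewrite ?mulr1n ?mulr0n.
Qed.

Lemma dual_idempotent_sum : \sum_(i < D.+1) Es i = 1%:M.
Proof.
apply/matrixP => a b; rewrite summxE [RHS]mxE.
have ltD : (gdist e y (enum_val a) < D.+1)%N by rewrite ltnS gdist_le_diameter.
rewrite (bigD1 (Ordinal ltD)) //= big1 ?addr0 => [|i neq].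
  by rewrite dual_idempotent_entry eqxx andbT.
rewrite dual_idempotent_entry [_ == val i]eq_sym -[val i == _]/(i == Ordinal ltD).
by rewrite (negPf neq) andbF.
Qed.

Lemma dual_idempotent_tr i : (Es i)^T = Es i.
Proof. exact: tr_diag_mx. Qed.

Lemma dual_idempotent_mul i j : Es i *m Es j = if i == j then Es i else 0.
Proof.
rewrite /dual_idempotent mulmx_diag; case: eqVneq => [->|neq].
  by congr diag_mx; apply/rowP => a; rewrite !mxE -natrM mulnb andbb.
rewrite -[RHS](raddf0 (@diag_mx R #|X|)); congr diag_mx; apply/rowP => a; rewrite !mxE.
by case: eqVneq => [->|_]; rewrite ?mul0r // (negPf neq) mulr0.
Qed.

Lemma dual_idempotent_gt i : (D < i)%N -> Es i = 0.
Proof.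
move=> ltDi; apply/matrixP => a b; rewrite dual_idempotent_entry [RHS]mxE.
suff -> : (gdist e y (enum_val a) == i) = false by rewrite andbF.
by apply/negbTE; rewrite neq_ltn (leq_ltn_trans (gdist_le_diameter _ _)).
Qed.

Lemma dual_idempotent_tri i j : (1 < (i - j) + (j - i))%N -> Es i *m A *m Es j = 0.
Proof.
move=> gap; apply/matrixP => a b.
rewrite /dual_idempotent mul_diag_mx mul_mx_diag !mxE.
have [eab|_] := boolP (e _ _); last by rewrite mulr0 mul0r.
have eba : e (enum_val b) (enum_val a) by rewrite e_sym.
have := gdist_step y eab; have := gdist_step y eba; rewrite ![gdist e _ y]gdist_sym.
case: eqP => [->|_]; last by rewrite !mul0r.
by case: eqP => [->|_]; [move: gap; lia | rewrite mulr0].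
Qed.

End DualIdempotents.
End DistanceFacts.

(** * Primitive idempotents *)

Section PrimitiveIdempotents.
Variables (R : realType) (X : finType) (e : rel X).
Hypothesis e_sym : symmetric e.
Local Notation A := (adjmx R e).
Local Notation F := (@primitive_idempotent R X e).

Lemma cap_orthogonal m n (U : 'M[R]_(m, n)) : (U :&: kermx U^T)%MS = 0.
Proof.
apply/eqP; rewrite -submx0; apply/rV_subP => w; rewrite sub_capmx submx0.
case/andP => /submxP[c wU] /sub_kermxP wUt.
apply/eqP/trmx_inj; rewrite trmx0; apply: dotc_eq0.
by rewrite /dotc trmxK {2}wU trmx_mul mulmxA wUt mul0mx mxE.
Qed.

Lemma add_orthogonal m n (U : 'M[R]_(m, n)) : (1%:M <= U + kermx U^T)%MS.
Proof.
rewrite sub1mx /row_full; have := mxrank_sum_cap U (kermx U^T).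
by rewrite cap_orthogonal mxrank0 addn0 mxrank_ker mxrank_tr subnKC ?rank_leq_col // => ->.
Qed.

Lemma primitive_idempotent_sub a : F a *m A = a *: F a.
Proof. by apply/eigenspaceP; rewrite -[F a]mul1mx proj_mx_sub. Qed.

(** The rows of 1 - F are orthogonal to the eigenspace, which contains those of F; hence F^T = F
    F^T, which is symmetric. *)
Lemma primitive_idempotent_tr a : (F a)^T = F a.
Proof.
have /sub_kermxP perp : (1%:M - F a <= kermx (eigenspace A a)^T)%MS.
  rewrite -[X in _ - X]mul1mx; apply: proj_mx_compl_sub; exact: add_orthogonal.
have /submxP[C FC] : (F a <= eigenspace A a)%MS by rewrite -[F a]mul1mx proj_mx_sub.
have : (1%:M - F a) *m (F a)^T = 0 by rewrite {2}FC trmx_mul mulmxA perp mul0mx.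
rewrite mulmxBl mul1mx => /subr0_eq FF.
by have := congr1 trmx FF; rewrite (trmx_mul (F a)) !trmxK -FF.
Qed.

Lemma primitive_idempotent_id a (v : 'cV[R]_#|X|) :
  A *m v = a *: v -> F a *m v = v.
Proof.
move=> Av; rewrite -[F a]primitive_idempotent_tr -[v in LHS]trmxK -trmx_mul.
rewrite proj_mx_id ?trmxK ?cap_orthogonal //.
by apply/eigenspaceP; rewrite -[A](adj_tr R e_sym) -trmx_mul Av linearZ.
Qed.

Lemma primitive_idempotent_eigen a : A *m F a = a *: F a.
Proof.
by rewrite -[LHS]trmxK (trmx_mul A) adj_tr // primitive_idempotent_tr primitive_idempotent_sub
  linearZ /= primitive_idempotent_tr.
Qed.

Lemma primitive_idempotent_mul a b : F a *m F b = if a == b then F b else 0.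
Proof.
case: eqVneq => [->|neq].
  rewrite -[LHS]subr0 -[RHS]addr0; apply/eqP; rewrite subr0 addr0 -subr_eq0; apply/eqP.
  apply: mulmx_cV_eq0 => v; rewrite mulmxBl -mulmxA.
  rewrite primitive_idempotent_id ?subrr // mulmxA primitive_idempotent_eigen.
  by rewrite -scalemxAl.
have eq_ab : a *: (F a *m F b) = b *: (F a *m F b).
  rewrite (scalemxAl a (F a)) -primitive_idempotent_sub -(mulmxA (F a)).
  by rewrite primitive_idempotent_eigen -(scalemxAr b (F a)).
have /eqP : (a - b) *: (F a *m F b) = 0 by rewrite scalerBl eq_ab subrr.
by rewrite scaler_eq0 subr_eq0 (negPf neq) => /eqP.
Qed.

Section Ordering.
Variable theta : 'I_(diameter e).+1 -> R.
Hypothesis theta_ord : eigenvalue_ordering theta.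

(** Otherwise the common kernel of the idempotents is nonzero and A-stable, so it contains an
    eigenvector of A; but its own idempotent fixes that vector. *)
Lemma primitive_idempotent_sum : \sum_i F (theta i) = 1%:M.
Proof.
have [theta_inj thetaE _] := theta_ord.
apply/esym/subr0_eq/mulmx_cV_eq0 => v; set S := \sum_i _.
pose U (w : 'cV[R]_#|X|) := forall i, F (theta i) *m w = 0.
have Usub : subspace_pred U.
  split=> [i|a x y Ux Uy i]; first by rewrite mulmx0.
  by rewrite mulmxDr -scalemxAr Ux Uy scaler0 addr0.
apply/eqP; apply: contraT => nz.
have [|||||a [w [Uw w0 Aw]]] := @symmetric_eigenvector R _ A U ((1%:M - S) *m v).
- exact: adj_tr.
- exact: Usub.
- move=> w Uw i; rewrite mulmxA primitive_idempotent_sub -scalemxAl Uw scaler0 //.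
- move=> i; rewrite mulmxA mulmxBr mulmx1 /S mulmx_sumr (bigD1 i) //=.
  rewrite primitive_idempotent_mul eqxx big1 ?addr0 ?subrr ?mul0mx // => j neq.
  by rewrite primitive_idempotent_mul (inj_eq theta_inj) eq_sym (negPf neq).
- exact: nz.
have /thetaE[i theta_i] : eigenvalue A a.
  apply/eigenvalueP; exists w^T; last by rewrite -(inj_eq trmx_inj) trmxK trmx0.
  by rewrite -[A](adj_tr R e_sym) -trmx_mul Aw linearZ.
by move: w0; rewrite -(primitive_idempotent_id Aw) -theta_i Uw eqxx.
Qed.

End Ordering.
End PrimitiveIdempotents.

(** * Consequences of the Q-polynomial property *)

Section SquaredNorm.
Variables (R : realType) (n : nat).
Implicit Types E F M : 'M[R]_n.

Lemma trace_self_eq0 M : \tr (M *m M^T) = 0 -> M = 0.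
Proof.
rewrite /mxtrace; under eq_bigr do (rewrite mxE; under eq_bigr do rewrite mxE -expr2).
move/psumr_eq0P => M0; apply/matrixP => i j; rewrite mxE; apply/eqP; rewrite -sqrf_eq0.
have := M0 (fun i _ => sumr_ge0 _ (fun j _ => sqr_ge0 _)) i isT.
by move/psumr_eq0P => -> // k _; exact: sqr_ge0.
Qed.

(** By cyclicity and idempotence the squared norm collapses to a form in the entrywise product of E
    and F, where Krein parameters can enter. *)
Lemma trace_diag_idempotents (s : 'rV[R]_n) E F :
  E^T = E -> F^T = F -> E *m E = E -> F *m F = F ->
  \tr ((E *m diag_mx s *m F) *m (E *m diag_mx s *m F)^T) =
  \sum_a \sum_b s 0 a * s 0 b * (E a b * F a b).
Proof.
move=> symE symF EE FF; rewrite !trmx_mul symE symF tr_diag_mx.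
have -> : \tr (E *m diag_mx s *m F *m (F *m (diag_mx s *m E))) =
    \tr (E *m diag_mx s *m (F *m diag_mx s)).
  rewrite -!mulmxA mxtrace_mulC -!mulmxA EE [F *m (F *m _)]mulmxA FF.
  by rewrite [RHS]mxtrace_mulC -!mulmxA.
rewrite /mxtrace; apply: eq_bigr => a _; rewrite mxE; apply: eq_bigr => b _.
rewrite !mul_mx_diag !mxE -{1}symF mxE; ring.
Qed.

Lemma symmetric_sandwich E M i : E^T = E ->
  (E *m M *m E) i i = \sum_a \sum_b E i a * E i b * M a b.
Proof.
move=> symE; rewrite mxE exchange_big; apply: eq_bigr => b _ /=; rewrite mxE mulr_suml.
have -> : E b i = E i b by rewrite -{1}symE mxE.
by apply: eq_bigr => a _; ring.
Qed.

End SquaredNorm.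

Section QPolynomial.
Variables (R : realType) (X : finType) (e : rel X).
Hypothesis e_sym : symmetric e.
Hypothesis e_irr : irreflexive e.
Hypothesis e_conn : forall y z : X, connect e y z.
Hypothesis D_ge1 : (1 <= diameter e)%N.
Hypothesis e_dr : distance_regular e.
Local Notation A := (adjmx R e).
Local Notation D := (diameter e).
Variable theta : 'I_D.+1 -> R.
Hypothesis theta_ord : eigenvalue_ordering theta.
Variable q : 'I_D.+1 -> 'I_D.+1 -> 'I_D.+1 -> R.
Hypothesis q_krein : krein_parameters theta q.
Hypothesis q_zero : forall h i j : 'I_D.+1,
  [|| (i + j < h)%N, (h + j < i)%N | (h + i < j)%N] -> q h i j = 0.
Hypothesis q_neq0 : forall h i j : 'I_D.+1,
  [|| h == i + j :> nat, i == h + j :> nat | j == h + i :> nat]%N -> q h i j != 0.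

Definition eigval (k : nat) : R := theta (inord k).
Definition idem (k : nat) : 'M[R]_#|X| := primitive_idempotent e (eigval k).

Lemma eigval_inj : {in [pred i | (i <= D)%N] &, injective eigval}.
Proof.
have [theta_inj _ _] := theta_ord.
move=> i j lei lej /theta_inj eq_ij.
by rewrite -(inordK (lei : (i < D.+1)%N)) eq_ij inordK.
Qed.

Lemma idem_ord (i : 'I_D.+1) : idem i = primitive_idempotent e (theta i).
Proof. by rewrite /idem /eigval inord_val. Qed.

Lemma idem_sum : \sum_(i < D.+1) idem i = 1%:M.
Proof.
rewrite -(primitive_idempotent_sum e_sym theta_ord).
by apply: eq_bigr => i _; rewrite idem_ord.
Qed.

Lemma idem_mul i j : (i <= D)%N -> (j <= D)%N ->
  idem i *m idem j = if i == j then idem i else 0.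
Proof.
move=> lei lej; rewrite primitive_idempotent_mul // (inj_in_eq eigval_inj) //.
by case: eqVneq => [->|].
Qed.

Lemma adj_pow_idem k : A ^+ k = \sum_(i < D.+1) eigval i ^+ k *: idem i.
Proof.
apply: (pow_eigen_sum idem_sum) => i _; exact: primitive_idempotent_eigen.
Qed.

(** The entries of powers of A depend only on distance; interpolation modulo the matrices whose two
    entries agree passes this to E_i. *)
Lemma idem_index_dist i a b a' b' : (i <= D)%N -> index_dist e a b = index_dist e a' b' ->
  idem i a b = idem i a' b'.
Proof.
move=> leiD eq_d; pose Z (M : 'M[R]_#|X|) := M a b = M a' b'.
have Zsub : subspace_pred Z.
  by split=> [|c M N ZM ZN]; rewrite /Z !mxE // ZM ZN.
apply: (@vandermonde_subspace _ _ Z Zsub D 0 D.+1 eigval idem) => // [|f _|k lek].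
- exact: eigval_inj.
- rewrite (@horner_eigen_sum _ _ D A idem eigval idem_sum
    (fun i _ => primitive_idempotent_eigen e_sym _)).
  apply: (subspace_pred_sum Zsub) => k _; apply: (subspace_predZ Zsub).
  exact: adj_pow_index_dist.
- by rewrite add0n ltnS lek.
Qed.

Lemma krein_entry (i j : 'I_D.+1) a b :
  idem i a b * idem j a b = #|X|%:R^-1 * \sum_(h < D.+1) q h i j * idem h a b.
Proof.
have /matrixP/(_ a b) := q_krein i j; rewrite mxE -!idem_ord => ->.
rewrite mxE summxE; congr (_ * _); apply: eq_bigr => h _.
by rewrite mxE idem_ord.
Qed.

Lemma card_unit (a : 'I_#|X|) : #|X|%:R^-1 != 0 :> R.
Proof. by rewrite invr_eq0 pnatr_eq0 -lt0n (leq_ltn_trans _ (ltn_ord a)). Qed.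

(* The Krein parameters q^h_{0j} vanish for h <> j, so E_0 o E_j is a nonzero    *)
(* multiple of E_j: where E_0 vanishes, so does every E_j, hence I, A, A^2, ...  *)
Lemma idem0_const a b a' b' : idem 0 a b = idem 0 a' b'.
Proof.
suff const c d : idem 0 c d = #|X|%:R^-1 * q ord0 ord0 ord0 by rewrite !const.
have krein0 (j : 'I_D.+1) : idem 0 c d * idem j c d = #|X|%:R^-1 * q j ord0 j * idem j c d.
  rewrite (krein_entry ord0) (bigD1 j) //= big1 ?addr0 ?mulrA // => h neq.
  rewrite q_zero ?mul0r //; move: neq; rewrite -(inj_eq val_inj) /=.
  by rewrite neq_ltn add0n addn0 => /orP[->|->]; rewrite ?orbT.
have [E0|E0] := eqVneq (idem 0 c d) 0; last by apply: (mulIf E0); exact: (krein0 ord0).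
have Ej0 (j : 'I_D.+1) : idem j c d = 0.
  have /eqP := krein0 j; rewrite E0 mul0r eq_sym !mulf_eq0 (negPf (card_unit c)) /=.
  by rewrite (negPf (q_neq0 _)) ?add0n ?addn0 ?eqxx //= => /eqP.
have := walk_gdist e_conn (enum_val c) (enum_val d).
rewrite -(adj_pow_walk R) adj_pow_idem summxE big1 ?eqxx // => j _.
by rewrite mxE Ej0 mulr0.
Qed.

(** By induction the entries of E_1, ..., E_j determine that of E_(j+1): in the Krein expansion of
    the entrywise product of E_j and E_1 it is the last term, with nonzero coefficient. All powers
    of A are then determined, hence the distance. *)
Lemma idem1_separates a b a' b' : idem 1 a b = idem 1 a' b' -> index_dist e a b = index_dist e a' b'.
Proof.
move=> eq1; suff eqE (j : nat) : (j <= D)%N -> idem j a b = idem j a' b'.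
  apply: (index_dist_eq_of_adj_pow (R := R)) => k; rewrite adj_pow_idem !summxE.
  by apply: eq_bigr => j _; rewrite [LHS]mxE [RHS]mxE eqE // -ltnS.
elim/ltn_ind: j => [[|j]] IH ltjD; first exact: idem0_const.
pose o1 : 'I_D.+1 := Ordinal (D_ge1 : (1 < D.+1)%N).
pose oj : 'I_D.+1 := Ordinal (ltnW ltjD : (j < D.+1)%N).
pose oj1 : 'I_D.+1 := Ordinal (ltjD : (j.+1 < D.+1)%N).
have := krein_entry oj o1 a b.
rewrite /= eq1 IH ?ltnSn // ?(ltnW ltjD) // (krein_entry oj o1).
move/(mulfI (card_unit a))/eqP; rewrite -subr_eq0 -sumrB (bigD1 oj1) //= big1 ?addr0.
  rewrite -mulrBr mulf_eq0 (negPf (q_neq0 _)) /=; last by rewrite addn1 eqxx.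
  by rewrite subr_eq0 => /eqP.
move=> h neq; have [lth|leh] := ltnP h j.+1.
  by rewrite (IH _ lth) ?subrr // -ltnS.
rewrite q_zero ?mul0r ?subrr // addn1 /= ltn_neqAle leh andbT.
by rewrite eq_sym -[val h == _]/(h == oj1) neq.
Qed.

(** * The dual adjacency matrix at a vertex *)

Section BaseVertex.
Variable y : X.
Local Notation Es := (dual_idempotent R e y).
Local Notation iy := (enum_rank y).

(** The dual adjacency matrix A* without its customary factor |X|. *)
Definition dual_adj : 'M[R]_#|X| := diag_mx (row iy (idem 1)).

(* The values at the s for which the sphere is empty only keep this injective.    *)
Definition dual_eigenvalue (s : nat) : R :=
  if [pick x | gdist e y (enum_val x) == s] is Some x then idem 1 iy x
  else 1 + \sum_x `|idem 1 iy x| + s%:R.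

Lemma dual_eigenvalue_inj : injective dual_eigenvalue.
Proof.
have bound x : idem 1 iy x <= \sum_x `|idem 1 iy x|.
  by rewrite (le_trans (ler_norm _)) // (bigD1 x) //= lerDl sumr_ge0.
have apart x (s : nat) : idem 1 iy x = 1 + \sum_x `|idem 1 iy x| + s%:R -> False.
  by move=> eq_s; have := bound x; have := ler0n R s; lra.
move=> s t; rewrite /dual_eigenvalue.
case: pickP => [x /eqP dx|_]; case: pickP => [z /eqP dz|_].
- move/idem1_separates; rewrite /index_dist enum_rankK => eq_d.
  by rewrite -dx -dz eq_d.
- by move/apart.
- by move/esym/apart.
- by move/addrI/eqP; rewrite eqr_nat => /eqP.
Qed.

Lemma dual_adj_eigen s : dual_adj *m Es s = dual_eigenvalue s *: Es s.
Proof.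
apply/matrixP => a b; rewrite mul_diag_mx mxE [RHS]mxE dual_idempotent_entry.
case: andP => [[_ da]|_]; last by rewrite !mulr0.
rewrite !mulr1 mxE /dual_eigenvalue; case: pickP => [x dx|/(_ a)]; last by rewrite da.
by apply: idem_index_dist => //; rewrite /index_dist enum_rankK (eqP da) (eqP dx).
Qed.

(* The squared Frobenius norm of E_i A* E_j is a multiple of q^1_{ij}. *)
Lemma idem_dual_tri i j : (i <= D)%N -> (j <= D)%N ->
  (1 < (i - j) + (j - i))%N -> idem i *m dual_adj *m idem j = 0.
Proof.
move=> lei lej gap; apply: trace_self_eq0.
have Etr k : (idem k)^T = idem k by exact: primitive_idempotent_tr.
rewrite trace_diag_idempotents ?Etr ?idem_mul ?eqxx //.
pose oi : 'I_D.+1 := Ordinal (lei : (i < D.+1)%N).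
pose oj : 'I_D.+1 := Ordinal (lej : (j < D.+1)%N).
pose s a := row iy (idem 1) 0 a.
(* For h = 1 the gap between i and j kills the Krein parameter; for other h the double sum is a
   diagonal entry of E_1 E_h E_1 = 0. *)
have Eh0 (h : 'I_D.+1) : q h oi oj * (\sum_a \sum_b s a * s b * idem h a b) = 0.
  have [h1|hn1] := eqVneq (val h) 1%N.
    by rewrite q_zero ?mul0r //=; move: h1 => /= ->; move: gap; lia.
  have -> : \sum_a \sum_b s a * s b * idem h a b = (idem 1 *m idem h *m idem 1) iy iy.
    rewrite symmetric_sandwich //; apply: eq_bigr => a _; apply: eq_bigr => b _.
    by congr (_ * _ * _); exact: mxE.
  rewrite (idem_mul (i := 1)) // -1?ltnS // eq_sym (negPf hn1) mul0mx.
  by rewrite [X in _ * X]mxE mulr0.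
transitivity (#|X|%:R^-1 * \sum_(h < D.+1) q h oi oj * (\sum_a \sum_b s a * s b * idem h a b)).
  rewrite mulr_sumr; under [RHS]eq_bigr do rewrite !mulr_sumr.
  rewrite [RHS]exchange_big; apply: eq_bigr => a _ /=.
  under [RHS]eq_bigr do rewrite !mulr_sumr.
  rewrite [RHS]exchange_big; apply: eq_bigr => b _ /=.
  rewrite (krein_entry oi oj) !mulr_sumr; apply: eq_bigr => h _.
  by rewrite /s; ring.
by rewrite big1 ?mulr0.
Qed.

End BaseVertex.
End QPolynomial.

(** * Sharpness *)

Section DualImage.
Variables (R : realType) (X : finType) (e : rel X) (y : X).
Variable W : {vspace 'cV[R]_#|X|}.
Local Notation D := (diameter e).
Local Notation Es := (dual_idempotent R e y).

Lemma memv_dual_image i v :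
  reflect (exists2 w, w \in W & v = Es i *m w) (v \in dual_image e y i W).
Proof.
by apply: (iffP memv_imgP) => [[w wW ->]|[w wW ->]]; exists w; rewrite ?lfunE.
Qed.

Lemma dual_image_eq0 i v : dual_image e y i W = 0%VS -> v \in W -> Es i *m v = 0.
Proof.
move=> W0 vW; apply/eqP; rewrite -memv0 -W0.
by apply/memv_dual_image; exists v.
Qed.

Lemma endpoint_has : W != 0%VS -> has (fun i => dual_image e y i W != 0%VS) (iota 0 D.+1).
Proof.
apply: contraR => /hasPn none; rewrite -subv0; apply/subvP => v vW.
rewrite memv0 -[v]mul1mx -(dual_idempotent_sum R e y) mulmx_suml big1 // => i _.
apply: dual_image_eq0 vW; apply/eqP; rewrite -[_ == _]negbK; apply: none.
by rewrite mem_iota ltn_ord.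
Qed.

Lemma dual_image_endpoint : W != 0%VS -> dual_image e y (endpoint e y W) W != 0%VS.
Proof.
move=> /endpoint_has hasW; have := nth_find 0%N hasW.
by rewrite nth_iota // -[X in (_ < X)%N](size_iota 0) -has_find.
Qed.

Lemma endpoint_lt i v : (i < endpoint e y W)%N -> v \in W -> Es i *m v = 0.
Proof.
move=> lti; apply: dual_image_eq0; apply/eqP.
have ltD : (i < D.+1)%N.
  by rewrite (leq_trans lti) // -[X in (_ <= X)%N](size_iota 0) find_size.
by have := before_find 0%N lti; rewrite nth_iota // => /negbFE.
Qed.

End DualImage.

Theorem corollary1p2 (R : realType) (X : finType) (e : rel X)
    (e_sym : symmetric e) (e_irr : irreflexive e)
    (e_conn : forall y z : X, connect e y z)
    (D_ge1 : (1 <= diameter e)%N)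
    (e_dr : distance_regular e)
    (e_Qpoly : Q_polynomial R e) :
  sharp R e.
Proof.
move=> y W [WT W0 Wirr]; have [theta [theta_ord [q q_krein q_vals]]] := e_Qpoly.
have q_zero h i j := (q_vals h i j).1; have q_neq0 h i j := (q_vals h i j).2.
pose D := diameter e; pose A := adjmx R e; pose Es := dual_idempotent R e y.
set r := endpoint e y W.
have WA v : v \in W -> A *m v \in W by apply: WT; exact: terwilliger_adj.
have WEs i v : v \in W -> Es i *m v \in W.
  have [ltDi _|leiD] := ltnP D i; first by rewrite /Es dual_idempotent_gt // mul0mx mem0v.
  by apply: WT; exact: (terwilliger_dual _ _ (Ordinal (leiD : (i < D.+1)%N))).
have irr u : u != 0 -> forall U : {vspace 'cV[R]_#|X|}, (U <= W)%VS -> u \in U ->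
    (forall w, w \in U -> A *m w \in U) ->
    (forall i w, (i <= D)%N -> w \in U -> Es i *m w \in U) -> U = W.
  move=> u0 U UW uU UA UEs; have UT : T_module e y U.
    move=> B v inB; elim: inB v => [|i||B1 B2 _ IH1 _ IH2|a B1 _ IH1|B1 B2 _ IH1 _ IH2] v vU.
    - exact: UA.
    - by apply: UEs; rewrite // -ltnS.
    - by rewrite mul1mx.
    - by rewrite mulmxDl memvD ?IH1 ?IH2.
    - by rewrite -scalemxAl memvZ ?IH1.
    - by rewrite -mulmxA IH1 ?IH2.
  by case: (Wirr U UT UW) => // U0; move: uU u0; rewrite U0 memv0 => ->.
(* A nonzero vector of the bottom sphere, the seed for the common eigenvector. *)
have /memv_dual_image[w wW def_v] := memv_pick (dual_image e y r W).
have v0 : Es r *m w != 0 by rewrite -def_v vpick0 dual_image_endpoint.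
have EsEs (v : 'cV_#|X|) : Es r *m (Es r *m v) = Es r *m v.
  by rewrite mulmxA dual_idempotent_mul eqxx.
have th_inj := eigval_inj theta_ord.
have ths_inj := dual_eigenvalue_inj e_sym e_conn D_ge1 theta_ord q_krein q_zero q_neq0 (y := y).
have E_sum := idem_sum e_sym theta_ord.
have Es_sum := dual_idempotent_sum R e y.
have E_tr i : (idem theta i)^T = idem theta i by exact: primitive_idempotent_tr.
have Es_tr := @dual_idempotent_tr R X e y.
have E_mul := idem_mul e_sym theta_ord.
have Es_mul := @dual_idempotent_mul R X e y.
have Es_gt i : (diameter e < i)%N -> dual_idempotent R e y i = 0 by exact: dual_idempotent_gt.
have E_eigen i : (i <= diameter e)%N -> adjmx R e *m idem theta i = eigval theta i *: idem theta i.
  by move=> _; exact: primitive_idempotent_eigen.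
have Es_eigen i : (i <= diameter e)%N -> dual_adj theta y *m dual_idempotent R e y i =
    dual_eigenvalue theta y i *: dual_idempotent R e y i.
  by move=> _; exact: (dual_adj_eigen e_sym e_irr e_conn D_ge1 e_dr theta_ord).
have E_tri := idem_dual_tri e_sym D_ge1 theta_ord q_krein q_zero y.
have Es_tri i j : (i <= diameter e)%N -> (j <= diameter e)%N ->
    (1 < (i - j) + (j - i))%N ->
    dual_idempotent R e y i *m adjmx R e *m dual_idempotent R e y j = 0.
  by move=> _ _; exact: dual_idempotent_tri.
have W_lt i v : (i < r)%N -> v \in W -> dual_idempotent R e y i *m v = 0.
  by exact: endpoint_lt.
have [u [uW u0 Eu u_eigen]] := sphere_eigenvector th_inj ths_inj E_sum Es_sum E_tr Es_tr
  E_mul Es_mul Es_gt E_eigen Es_eigen E_tri Es_tri WA WEs W_lt (WEs r w wW) v0 (EsEs w).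
have line := sphere_line th_inj ths_inj E_sum Es_sum E_mul Es_mul Es_gt E_eigen
  Es_eigen E_tri Es_tri WA WEs W_lt uW Eu u_eigen (irr u u0).
suff -> : dual_image e y r W = <[u]>%VS by rewrite dim_vline u0.
apply/eqP; rewrite eqEsubv; apply/andP; split; apply/subvP => v.
  case/memv_dual_image => x xW ->; have [a] := line x xW.
  by rewrite /Es => ->; rewrite memvZ ?memv_line.
case/vlineP => a ->; rewrite memvZ //; apply/memv_dual_image.
by exists u; rewrite // -[LHS]Eu.
Qed.
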